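(* Let $F$ be a finitely generated free group of rank at least two. Then the quotient of $\mathrm{Comm}(F)$ by its normal subgroup $\mathrm{AComm}(F)$ is a free abelian group of infinite rank.
   Context: Let $\Gamma$ be a group. A virtual isomorphism of $\Gamma$ is an isomorphism $\varphi: A \to B$ between finite index subgroups $A,B$ of $\Gamma$. Two virtual isomorphisms are equivalent if they agree on a common finite index subgroup of their domains; $[\varphi]$ denotes the equivalence class. The composition of $\varphi: A\to B$ followed by $\psi: C \to D$ is the isomorphism $\varphi^{-1}(B\cap C) \to \psi(B\cap C)$, $x \mapsto \psi(\varphi(x))$. Equivalence classes of virtual isomorphisms of $\Gamma$ form a group under composition, the abstract commensurator $\mathrm{Comm}(\Gamma)$. For a finite index subgroup $A$ of $\Gamma$, every automorphism of $A$ is a virtual isomorphism of $\Gamma$, giving a homomorphism $a_A : \mathrm{Aut}(A) \to \mathrm{Comm}(\Gamma)$. $\mathrm{AComm}(\Gamma)$ is the subgroup of $\mathrm{Comm}(\Gamma)$ generated by all the subgroups $a_A(\mathrm{Aut}(A))$, where $A$ ranges over the finite index subgroups of $\Gamma$; when $\Gamma$ is finitely generated it is known to be normal in $\mathrm{Comm}(\Gamma)$. *)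

(* Defs.v *)
From HB Require Import structures.
From mathcomp Require Import all_boot all_algebra.
From mathcomp Require Import boolp classical_sets functions cardinality.
From mathcomp.multinomials Require Import freeg.

Set Implicit Arguments.
Unset Strict Implicit.
Unset Printing Implicit Defensive.

Local Open Scope classical_set_scope.
Local Open Scope quotient_scope.
Local Open Scope group_scope.

Section Subgroups.
Variable G : groupType.
Implicit Types A B S : set G.

Definition subgroup A := A 1 /\ (forall x y, A x -> A y -> A (x / y)).

Definition generated S : set G := smallest subgroup S.

Definition finitely_generated := exists s : seq G, generated [set` s] = setT.

Definition lcoset A (x : G) : set G := [set x * a | a in A].

Definition finite_index A := finite_set (range (lcoset A)).

Definition fi_subgroup A := subgroup A /\ finite_index A.

Definition normal_subgroup A :=
  subgroup A /\ (forall x y, A x -> A (x ^ y)).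

Lemma subgroup1 A : subgroup A -> A 1.
Proof. by case. Qed.

Lemma subgroupV A x : subgroup A -> A x -> A x^-1.
Proof. by case=> A1 AF Ax; rewrite -div1g; apply: AF. Qed.

Lemma subgroupM A x y : subgroup A -> A x -> A y -> A (x * y).
Proof.
by move=> sA Ax Ay; rewrite -[y]invgK; apply: sA.2 => //; apply: subgroupV.
Qed.

Lemma subgroupVM A x y : subgroup A -> A x -> A y -> A (x^-1 * y).
Proof. by move=> sA Ax Ay; apply: subgroupM => //; apply: subgroupV. Qed.

Lemma lcoset_refl A x : subgroup A -> lcoset A x x.
Proof. by move=> sA; exists 1; rewrite ?mulg1//; apply: subgroup1. Qed.

Lemma lcoset_eqP A x y : subgroup A -> lcoset A x = lcoset A y -> A (x^-1 * y).
Proof.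
by move=> sA e; have := lcoset_refl y sA; rewrite -e => -[a Aa <-]; rewrite mulKg.
Qed.

(* Depends on [x] only through the coset [lcoset A x]. *)
Definition lrep A x : G := xget 1 (lcoset A x).

Lemma lrepP A x : subgroup A -> A ((lrep A x)^-1 * x).
Proof.
move=> sA; have [a Aa <-] : lcoset A x (lrep A x).
  by apply: xgetPex; exists x; apply: lcoset_refl.
by rewrite invgM mulgVK; apply: subgroupV.
Qed.

Lemma finite_index_sep (T : Type) (c : G -> T) A : subgroup A ->
  finite_set (range c) -> (forall x y, c x = c y -> A (x^-1 * y)) ->
  finite_index A.
Proof.
move=> sA fc cP.
pose g t : G := xget 1 [set x | c x = t].
apply: (@sub_finite_set _ _ [set lcoset A (g t) | t in range c]); last first.
  exact: finite_image.
move=> _ [x _ <-]; exists (c x); first by exists x.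
have cg : c (g (c x)) = c x.
  by apply: (@xgetPex _ 1 [set y | c y = c x]); exists x.
have Ag := cP _ _ cg.
apply/seteqP; split => [_ [a Aa <-]|_ [a Aa <-]].
  exists (x^-1 * (g (c x) * a)); rewrite ?mulVKg// mulgA.
  by apply: subgroupM => //; apply: cP.
exists ((g (c x))^-1 * (x * a)); rewrite ?mulVKg// mulgA.
exact: subgroupM.
Qed.

Lemma fi_subgroupI A B : fi_subgroup A -> fi_subgroup B -> fi_subgroup (A `&` B).
Proof.
move=> [sA fA] [sB fB].
have sAB : subgroup (A `&` B).
  split; first by split; apply: subgroup1.
  by move=> x y [Ax Bx] [Ay By]; split; [apply: sA.2|apply: sB.2].
split=> //; apply: (finite_index_sep (c := fun x => (lcoset A x, lcoset B x))) => //.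
  apply: (sub_finite_set _ (finite_setX fA fB)) => _ [x _ <-].
  by split; exists x.
by move=> x y [eA eB]; split; apply: lcoset_eqP.
Qed.

Lemma fi_subgroupT : fi_subgroup setT.
Proof.
split; first by split.
by apply: (finite_index_sep (c := fun=> tt)) => //; apply: finite_finset.
Qed.

Lemma morphV_on A f x : subgroup A -> {in A &, {morph f : x y / x * y : G}} ->
  A x -> f x^-1 = (f x)^-1 :> G.
Proof.
move=> sA fM Ax; have f1 : f 1 = 1 :> G.
  have A1 := subgroup1 sA.
  by apply: (@mulgI G (f 1)); rewrite -fM ?inE// !mulg1.
apply/esym/mulg1_eq; rewrite -fM ?inE ?mulgV//.
exact: subgroupV.
Qed.

Lemma morphVM_on A f x y : subgroup A ->
  {in A &, {morph f : x y / x * y : G}} ->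
  A x -> A y -> f (x^-1 * y) = (f x)^-1 * f y :> G.
Proof.
move=> sA fM Ax Ay; rewrite fM ?inE//; last exact: subgroupV.
by rewrite (morphV_on sA fM Ax).
Qed.

Lemma fi_subgroup_preim A f D : fi_subgroup A ->
  {in A &, {morph f : x y / x * y : G}} -> fi_subgroup D ->
  fi_subgroup (A `&` f @^-1` D).
Proof.
move=> [sA fA] fM [sD fD].
have sAD : subgroup (A `&` f @^-1` D).
  split.
    have A1 := subgroup1 sA; split=> //=.
    by rewrite -(mulVg 1) (morphVM_on sA fM)// mulVg; apply: subgroup1.
  move=> x y [Ax Dx] [Ay Dy]; split; first exact: sA.2.
  rewrite /= fM ?inE//; last exact: subgroupV.
  by rewrite (morphV_on sA fM)//; apply: sD.2.
split=> //.
pose c x := (lcoset A x, lcoset D (f ((lrep A x)^-1 * x))).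
apply: (finite_index_sep (c := c)) => //.
  apply: (sub_finite_set _ (finite_setX fA fD)) => _ [x _ <-].
  by split; [exists x|exists (f ((lrep A x)^-1 * x))].
move=> x y [eA eD]; split; first exact: lcoset_eqP.
have eD' := lcoset_eqP sD eD.
move: eD'; rewrite /lrep -eA -/(lrep A x).
have Ax := lrepP x sA; have := lrepP y sA; rewrite {1}/lrep -eA -/(lrep A x) => Ay.
rewrite -(morphVM_on sA fM)//= invgM invgK mulgA mulgK.
by [].
Qed.

End Subgroups.

Section VirtualIsomorphisms.
Variable G : groupType.

(* The values of [vfun] outside [vdom] are irrelevant: [vequiv] ignores them. *)
Record viso := VIso {
  vdom : set G;
  vcod : set G;
  vfun : G -> G;
  vdomP : fi_subgroup vdom;
  vcodP : fi_subgroup vcod;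
  vfunM : {in vdom &, {morph vfun : x y / x * y}};
  vfun_bij : set_bij vdom vcod vfun }.

HB.instance Definition _ := gen_eqMixin viso.
HB.instance Definition _ := gen_choiceMixin viso.

Implicit Types f g h : viso.

Definition vagree f g := exists C : set G,
  [/\ fi_subgroup C, C `<=` vdom f, C `<=` vdom g
    & forall x, C x -> vfun f x = vfun g x].

Definition vequiv f g : bool := `[< vagree f g >].

Lemma vequiv_refl : reflexive vequiv.
Proof. by move=> f; apply/asboolP; exists (vdom f); split=> //; apply: vdomP. Qed.

Lemma vequiv_sym : symmetric vequiv.
Proof.
suff H f g : vagree f g -> vagree g f by move=> f g; apply/asbool_equiv_eq; split; exact: H.
by move=> [C [fC Cf Cg e]]; exists C; split=> // x Cx; rewrite e.
Qed.

Lemma vequiv_trans : transitive vequiv.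
Proof.
move=> g f h /asboolP[C [fC Cf Cg e]] /asboolP[D [fD Dg Dh e']].
apply/asboolP; exists (C `&` D); split; first exact: fi_subgroupI.
- by move=> x [/Cf].
- by move=> x [_ /Dh].
- by move=> x [Cx Dx]; rewrite e// e'.
Qed.

Canonical vequiv_equiv := EquivRel vequiv vequiv_refl vequiv_sym vequiv_trans.

Lemma vfun_dom f x : vdom f x -> vcod f (vfun f x).
Proof. by have [+ _ _] := vfun_bij f; apply. Qed.

Lemma vfun_inj f x y :
  vdom f x -> vdom f y -> vfun f x = vfun f y -> x = y.
Proof. by move=> fx fy; have [_ + _] := vfun_bij f; apply; rewrite inE. Qed.

Definition vid : viso.
Proof.
refine (@VIso setT setT id (fi_subgroupT G) (fi_subgroupT G) _ _) => //.
by split=> // x _; exists x.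
Defined.

Definition vinvfun f (y : G) : G := xget 1 [set x | vdom f x /\ vfun f x = y].

Lemma vinvfunP f y : vcod f y -> vdom f (vinvfun f y) /\ vfun f (vinvfun f y) = y.
Proof.
move=> fy; apply: (@xgetPex _ 1 [set x | vdom f x /\ vfun f x = y]).
by have [_ _ /(_ _ fy)[x fx <-]] := vfun_bij f; exists x.
Qed.

Lemma vinvfunK f x : vdom f x -> vinvfun f (vfun f x) = x.
Proof.
move=> fx; have [fx' e] := vinvfunP (vfun_dom fx).
exact: (vfun_inj fx' fx).
Qed.

Lemma vinvfunM f : {in vcod f &, {morph vinvfun f : x y / x * y}}.
Proof.
move=> x y; rewrite !inE => fx fy.
have [fx' ex] := vinvfunP fx; have [fy' ey] := vinvfunP fy.
rewrite -{1}ex -{1}ey -vfunM ?inE// vinvfunK//.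
exact: subgroupM (vdomP f).1 _ _.
Qed.

Lemma vinvfun_bij f : set_bij (vcod f) (vdom f) (vinvfun f).
Proof.
split.
- by move=> y /vinvfunP[].
- move=> y z; rewrite !inE => /vinvfunP[_ ey] /vinvfunP[_ ez] e.
  by rewrite -ey -ez e.
- by move=> x fx; exists (vfun f x); [apply: vfun_dom|apply: vinvfunK].
Qed.

Definition vinv f : viso :=
  VIso (vcodP f) (vdomP f) (@vinvfunM f) (@vinvfun_bij f).

(* [vcomp g f] is [f] followed by [g]; the product of [Comm] is [g \o f]. *)
Definition vcomp_dom g f := vdom f `&` vfun f @^-1` (vcod f `&` vdom g).
Definition vcomp_cod g f := vfun g @` (vcod f `&` vdom g).

Lemma vcomp_domP g f : fi_subgroup (vcomp_dom g f).
Proof.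
apply: fi_subgroup_preim; [exact: vdomP|exact: vfunM|].
by apply: fi_subgroupI; [exact: vcodP|exact: vdomP].
Qed.

Lemma vcomp_codP g f : fi_subgroup (vcomp_cod g f).
Proof.
suff -> : vcomp_cod g f = vcod g `&` vinvfun g @^-1` (vcod f `&` vdom g).
  apply: fi_subgroup_preim; [exact: vcodP|exact: vinvfunM|].
  by apply: fi_subgroupI; [exact: vcodP|exact: vdomP].
apply/seteqP; split=> [_ [y [fy gy] <-]|z [gz [fz _]]].
  by split; [exact: vfun_dom|split; rewrite /= vinvfunK].
by have [gz' ez] := vinvfunP gz; exists (vinvfun g z).
Qed.

Lemma vcompM g f : {in vcomp_dom g f &, {morph vfun g \o vfun f : x y / x * y}}.
Proof.
move=> x y; rewrite !inE => -[fx [_ gx]] [fy [_ gy]] /=.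
by rewrite vfunM ?inE// vfunM ?inE.
Qed.

Lemma vcomp_bij g f :
  set_bij (vcomp_dom g f) (vcomp_cod g f) (vfun g \o vfun f).
Proof.
split.
- by move=> x [fx [fx' gx]]; exists (vfun f x).
- move=> x y; rewrite !inE => -[fx [_ gx]] [fy [_ gy]] /= e.
  by apply: (vfun_inj fx fy); apply: vfun_inj e.
- move=> _ [y [fy gy] <-]; have [fx ex] := vinvfunP fy.
  by exists (vinvfun f y); rewrite /= ?ex//; split=> //=; rewrite ex.
Qed.

Definition vcomp g f : viso :=
  VIso (vcomp_domP g f) (vcomp_codP g f) (@vcompM g f) (@vcomp_bij g f).

Lemma vagree_comp g g' f f' :
  vagree g g' -> vagree f f' -> vagree (vcomp g f) (vcomp g' f').
Proof.
move=> [D [fD Dg Dg' eg]] [C [fC Cf Cf' ef]].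
exists (C `&` vfun f @^-1` D); split.
- apply: fi_subgroup_preim => // x y; rewrite !inE => Cx Cy.
  by rewrite vfunM// inE; apply: Cf.
- move=> x [Cx Dx]; split; first exact: Cf.
  by split; [apply: vfun_dom; apply: Cf|apply: Dg].
- move=> x [Cx Dx]; split; first exact: Cf'.
  split; first by apply: vfun_dom; apply: Cf'.
  by apply: Dg'; rewrite -ef.
- by move=> x [Cx Dx] /=; rewrite -ef// eg.
Qed.

Lemma vagree_inv f f' : vagree f f' -> vagree (vinv f) (vinv f').
Proof.
move=> [C [fC Cf Cf' ef]].
have eD y : (vcod f `&` vinvfun f @^-1` C) y ->
    vcod f' y /\ vinvfun f y = vinvfun f' y.
  move=> [fy Cy]; have [fx ex] := vinvfunP fy.
  have f'x := Cf' _ Cy.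
  have e : vfun f' (vinvfun f y) = y by rewrite -ef.
  by split; [rewrite -e; apply: vfun_dom|rewrite -[in RHS]e vinvfunK].
exists (vcod f `&` vinvfun f @^-1` C); split.
- by apply: fi_subgroup_preim => //; [exact: vcodP|exact: vinvfunM].
- by move=> y [].
- by move=> y /eD[].
- by move=> y /eD[].
Qed.

Definition Comm : Type := {eq_quot vequiv}.
HB.instance Definition _ := Choice.on Comm.
HB.instance Definition _ := Quotient.on Comm.

Definition comm_class f : Comm := \pi_Comm f.

Lemma comm_classP f g : comm_class f = comm_class g <-> vagree f g.
Proof.
by split=> [/eqmodP/asboolP//|fg]; apply/eqmodP; apply/asboolP.
Qed.

Lemma comm_class_repr (a : Comm) : comm_class (repr a) = a.
Proof. exact: reprK. Qed.

Lemma vagree_repr f : vagree (repr (comm_class f)) f.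
Proof. by apply/comm_classP; rewrite comm_class_repr. Qed.

Definition comm_one : Comm := comm_class vid.
Definition comm_mul (a b : Comm) : Comm := comm_class (vcomp (repr a) (repr b)).
Definition comm_inv (a : Comm) : Comm := comm_class (vinv (repr a)).

Lemma comm_mulE g f :
  comm_mul (comm_class g) (comm_class f) = comm_class (vcomp g f).
Proof. by apply/comm_classP/vagree_comp; apply: vagree_repr. Qed.

Lemma comm_invE f : comm_inv (comm_class f) = comm_class (vinv f).
Proof. by apply/comm_classP/vagree_inv; apply: vagree_repr. Qed.

Lemma comm_mulA : associative comm_mul.
Proof.
move=> a b c; rewrite -(comm_class_repr a) -(comm_class_repr b).
rewrite -(comm_class_repr c) !comm_mulE; apply/comm_classP.
set h := repr a; set g := repr b; set f := repr c.
exists (vcomp_dom h (vcomp g f)); split=> //; first exact: vcomp_domP.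
move=> x [[fx [fx' gx]] [_ hx]]; split=> //=; split=> //; split=> //.
by split=> //; apply: vfun_dom.
Qed.

Lemma comm_mul1 : left_id comm_one comm_mul.
Proof.
move=> a; rewrite -(comm_class_repr a) comm_mulE; apply/comm_classP.
exists (vdom (repr a)); split=> //; first exact: vdomP.
by move=> x fx; split=> //; split=> //; apply: vfun_dom.
Qed.

Lemma comm_mulg1 : right_id comm_one comm_mul.
Proof.
move=> a; rewrite -(comm_class_repr a) comm_mulE; apply/comm_classP.
by exists (vdom (repr a)); split=> //; exact: vdomP.
Qed.

Lemma comm_mulVg : left_inverse comm_one comm_inv comm_mul.
Proof.
move=> a; rewrite -(comm_class_repr a) comm_invE comm_mulE; apply/comm_classP.
exists (vdom (repr a)); split=> //; first exact: vdomP.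
- by move=> x fx; have fx' := vfun_dom fx.
- by move=> x fx; rewrite /= vinvfunK.
Qed.

Lemma comm_mulgV : right_inverse comm_one comm_inv comm_mul.
Proof.
move=> a; rewrite -(comm_class_repr a) comm_invE comm_mulE; apply/comm_classP.
exists (vcod (repr a)); split=> //; first exact: vcodP.
- by move=> y fy; have [fy' _] := vinvfunP fy.
- by move=> y fy; have [_ ey] := vinvfunP fy.
Qed.

HB.instance Definition _ :=
  isGroup.Build Comm comm_mulA comm_mul1 comm_mulg1 comm_mulVg comm_mulgV.

(* The image of [Aut(A)]: an automorphism of [A] is exactly a virtual
   isomorphism with domain and codomain [A]. *)
Definition aut_classes (A : set G) : set Comm :=
  [set comm_class f | f in [set f | vdom f = A /\ vcod f = A]].

Definition AComm : set Comm :=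
  generated (\bigcup_(A in @fi_subgroup G) aut_classes A).

End VirtualIsomorphisms.

Arguments AComm G : clear implicits.

Section QuotientGroup.
Variables (G : groupType) (N : set G) (nN : normal_subgroup N).

Definition cosetr (x y : G) : bool := `[< N (x^-1 * y) >].

Lemma cosetr_refl : reflexive cosetr.
Proof. by move=> x; apply/asboolP; rewrite mulVg; apply: subgroup1 nN.1. Qed.

Lemma cosetr_sym : symmetric cosetr.
Proof.
suff H x y : N (x^-1 * y) -> N (y^-1 * x).
  by move=> x y; apply/asbool_equiv_eq; split; exact: H.
by move=> Nxy; rewrite -[x]invgK -invgM; apply: subgroupV nN.1 _.
Qed.

Lemma cosetr_trans : transitive cosetr.
Proof.
move=> y x z /asboolP Nxy /asboolP Nyz; apply/asboolP.
by rewrite -(mulVKg y z) mulgA; apply: subgroupM nN.1 _ _.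
Qed.

Canonical cosetr_equiv := EquivRel cosetr cosetr_refl cosetr_sym cosetr_trans.

Definition quotient_group : Type := {eq_quot cosetr}.
HB.instance Definition _ := Choice.on quotient_group.
HB.instance Definition _ := Quotient.on quotient_group.

Definition quo (x : G) : quotient_group := \pi_quotient_group x.

Lemma quoP x y : quo x = quo y <-> N (x^-1 * y).
Proof. by split=> [/eqmodP/asboolP//|H]; apply/eqmodP; apply/asboolP. Qed.

Lemma quo_repr (a : quotient_group) : quo (repr a) = a.
Proof. exact: reprK. Qed.

Definition quo_mul (a b : quotient_group) := quo (repr a * repr b).
Definition quo_inv (a : quotient_group) := quo (repr a)^-1.

Lemma quo_mulE x y : quo_mul (quo x) (quo y) = quo (x * y).
Proof.
apply/quoP; set x' := repr _; set y' := repr _.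
have Nx : N (x'^-1 * x) by apply/quoP; rewrite quo_repr.
have Ny : N (y'^-1 * y) by apply/quoP; rewrite quo_repr.
have -> : (x' * y')^-1 * (x * y) = (x'^-1 * x) ^ y' * (y'^-1 * y).
  by rewrite /conjg invgM !mulgA mulgK.
by apply: subgroupM nN.1 _ _ => //; apply: nN.2.
Qed.

Lemma quo_invE x : quo_inv (quo x) = quo x^-1.
Proof.
apply/quoP; set x' := repr _.
have Nx : N (x'^-1 * x) by apply/quoP; rewrite quo_repr.
have -> : x'^-1^-1 * x^-1 = ((x'^-1 * x)^-1) ^ x'^-1.
  by rewrite /conjg invgM !invgK !mulgA mulgK.
by apply: nN.2; apply: subgroupV nN.1 _.
Qed.

Lemma quo_mulA : associative quo_mul.
Proof.
move=> a b c; rewrite -(quo_repr a) -(quo_repr b) -(quo_repr c).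
by rewrite !quo_mulE mulgA.
Qed.

Lemma quo_mul1g : left_id (quo 1) quo_mul.
Proof. by move=> a; rewrite -(quo_repr a) quo_mulE mul1g. Qed.

Lemma quo_mulg1 : right_id (quo 1) quo_mul.
Proof. by move=> a; rewrite -(quo_repr a) quo_mulE mulg1. Qed.

Lemma quo_mulVg : left_inverse (quo 1) quo_inv quo_mul.
Proof. by move=> a; rewrite -(quo_repr a) quo_invE quo_mulE mulVg. Qed.

Lemma quo_mulgV : right_inverse (quo 1) quo_inv quo_mul.
Proof. by move=> a; rewrite -(quo_repr a) quo_invE quo_mulE mulgV. Qed.

HB.instance Definition _ :=
  isGroup.Build quotient_group quo_mulA quo_mul1g quo_mulg1 quo_mulVg quo_mulgV.

End QuotientGroup.

(* The universal property; taking [H] with at least two elements, it forces [X]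
   to be injective, so that the rank is the cardinality of [I]. *)
Definition free_basis (F : groupType) (I : Type) (X : I -> F) :=
  forall (H : groupType) (h : I -> H), exists f : {multiplicative F -> H},
    (forall i, f (X i) = h i) /\
    (forall g : {multiplicative F -> H}, (forall i, g (X i) = h i) -> g =1 f).

Definition free_abelian_of_infinite_rank (Q : groupType) :=
  exists I : choiceType, infinite_set [set: I] /\
  exists f : Q -> {freeg I / int},
    bijective f /\ {morph f : x y / x * y >-> (x + y)%R}.

(* Main.v *)
From Pilot Require Import Defs.
From HB Require Import structures.
From mathcomp Require Import all_boot all_algebra all_fingroup all_solvable.
From mathcomp Require Import boolp classical_sets functions cardinality.
From mathcomp.multinomials Require Import freeg.
Import Pilot.Defs.

(** Write Q for the quotient of Comm(F) by AComm(F).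

    The invariant.  For a finite group P, let the content of P be the multiset
    of its nonabelian composition factors; by Jordan-Hoelder it is additive on
    extensions.  If C <= A are subgroups of finite index and k is a
    homomorphism from A to a finite group whose kernel lies in C, then
    content k(A) - content k(C) does not depend on k ([content_pair]), so it
    only depends on the isomorphism class of the pair (A, C), and it is additive
    along chains.  Taking A = F defines the defect of C, and the difference of
    the defects of the codomain and of the domain of a virtual isomorphism is a
    homomorphism from Comm(F) to the free abelian group on the nonabelian finite
    simple groups ([comm_shiftM]).  It vanishes on automorphisms of subgroups
    of finite index, so it factors through Q.

    Injectivity.  By the Nielsen-Schreier index formula ([Schreier]) the
    subgroups of index n of F are all isomorphic, to a reference subgroup R_n
    with cyclic quotient ([cyclic_sub]).  All isomorphisms from R_n to a
    subgroup A have the same class x(A) in Q ([fi_coord]), and an isomorphism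
    from A to B has class x(B) x(A)^-1, so the coordinates x(A) describe Q
    completely.  The element x(A)^-1 x(C) of Q only depends on the isomorphism
    class of the pair (A, C) ([fi_coord_ratio]).

    The decisive fact is that two homomorphisms from free groups of the same
    large rank onto the same finite group P are isomorphic ([onto_on_unique]):
    there is room to change any generating tuple of P into any other by Nielsen
    moves.  Hence, when C is the kernel of a homomorphism from A onto P, the
    element x(A)^-1 x(C) depends only on P and on the index of A.  It is trivial
    when P is cyclic, by comparison with R_i and R_in, and computing the
    coordinate of the kernel of a homomorphism onto P x P' in two ways shows
    both that the index of A does not matter ([ker_coord_stable]) and that the
    resulting elements [group_class] of Q commute ([group_class_comm]).  They
    are multiplicative on extensions and trivial on cyclic groups, so the class
    of P is determined by the content of P ([group_class_content]).  Finally,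
    if k is a homomorphism from F to a finite group whose kernel lies in A, then
    x(A) is the quotient of the classes of k(F) and k(A)
    ([fi_coord_group_class]); so x(A) is determined by the defect of A, and a
    virtual isomorphism that does not change the defect is trivial in Q.

    Surjectivity.  For a nonabelian simple group S of order n, a free group of
    large rank maps onto both S and the cyclic group of order n; the two kernels
    have the same index, hence are isomorphic, and their defects differ by S.
    The rank is infinite because of the alternating groups. *)

Set Implicit Arguments.
Unset Strict Implicit.
Unset Printing Implicit Defensive.

Local Open Scope classical_set_scope.
Local Open Scope group_scope.


(** * Homomorphisms on subgroups and relative freeness *)

Section HomOn.
Variable F : groupType.
Implicit Types A B S : set F.

Definition hom_on (H : groupType) A (f : F -> H) :=
  forall x y, A x -> A y -> f (x * y) = f x * f y.

Lemma hom_onS (H : groupType) A B (f : F -> H) :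
  B `<=` A -> hom_on A f -> hom_on B f.
Proof. by move=> sBA hf x y /sBA Ax /sBA Ay; apply: hf. Qed.

Lemma hom_on1 (H : groupType) A (f : F -> H) :
  subgroup A -> hom_on A f -> f 1 = 1.
Proof.
move=> sA hf; have A1 := subgroup1 sA.
by apply: (@mulgI H (f 1)); rewrite -hf// !mulg1.
Qed.

Lemma hom_onV (H : groupType) A (f : F -> H) x :
  subgroup A -> hom_on A f -> A x -> f x^-1 = (f x)^-1.
Proof.
move=> sA hf Ax; apply/esym/mulg1_eq.
by rewrite -hf ?mulgV ?(hom_on1 sA hf)//; apply: subgroupV.
Qed.

Lemma subgroupT : subgroup [set: F]. Proof. by []. Qed.

Lemma subgroup_preim (gT : finGroupType) A (f : F -> gT) (P : {group gT}) :
  subgroup A -> hom_on A f -> subgroup [set x | A x /\ f x \in P].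
Proof.
move=> sA hf; split=> [|x y [Ax Px] [Ay Py]].
  by rewrite /= (hom_on1 sA hf); split=> //; apply: subgroup1.
split; first exact: sA.2.
by rewrite hf ?(hom_onV sA hf)//; [rewrite groupM ?groupV|apply: subgroupV].
Qed.

Lemma generated_subgroup S : subgroup (generated S).
Proof.
split=> [B [[]]//|x y Sx Sy B [sB SB]].
by apply: sB.2; [apply: Sx|apply: Sy].
Qed.

Lemma sub_generated S : S `<=` generated S.
Proof. by move=> x Sx B [_]; apply. Qed.

Lemma generated_sub S B : subgroup B -> S `<=` B -> generated S `<=` B.
Proof. by move=> sB SB x; apply. Qed.

Lemma hom_on_ext (H : groupType) S (f g : F -> H) :
    hom_on (generated S) f -> hom_on (generated S) g ->
    (forall x, S x -> f x = g x) ->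
  forall x, generated S x -> f x = g x.
Proof.
move=> hf hg e x Sx; have sS := generated_subgroup S.
suff [] : [set x | generated S x /\ f x = g x] x by [].
move: x Sx; apply: generated_sub => [|x Sx]; last first.
  by split; [apply: sub_generated|apply: e].
split=> [|x y [Ax ex] [Ay ey]].
  by split; rewrite ?(hom_on1 sS hf) ?(hom_on1 sS hg)//; apply: subgroup1.
split; first exact: sS.2.
have Vy := subgroupV sS Ay.
by rewrite hf// hg// (hom_onV sS hf)// (hom_onV sS hg)// ex ey.
Qed.

(** Freeness of a subgroup is expressed inside the ambient group, because the
    domains of virtual isomorphisms are subsets of F. *)
Definition free_on A (T : Type) (y : T -> F) := A = generated (range y) /\
  forall (H : groupType) (h : T -> H), exists f : F -> H,
    hom_on A f /\ forall t, f (y t) = h t.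

Lemma free_on_subgroup A T (y : T -> F) : free_on A y -> subgroup A.
Proof. by case=> -> _; apply: generated_subgroup. Qed.

Lemma free_on_mem A T (y : T -> F) t : free_on A y -> A (y t).
Proof. by case=> -> _; apply: sub_generated; exists t. Qed.

Lemma free_on_ext A T (y : T -> F) (H : groupType) (f g : F -> H) :
    free_on A y -> hom_on A f -> hom_on A g -> (forall t, f (y t) = g (y t)) ->
  forall x, A x -> f x = g x.
Proof.
case=> -> _ hf hg e; apply: hom_on_ext => // x [t _ <-]; exact: e.
Qed.

Lemma free_on_reindex A T U (y : T -> F) (s : U -> T) :
  bijective s -> free_on A y -> free_on A (y \o s).
Proof.
case=> s' sK s'K [eA univ]; split=> [|H h].
  rewrite eA; congr generated; apply/seteqP; split=> _ [t _ <-].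
    by exists (s' t) => //=; rewrite s'K.
  by exists (s t).
have [f [hf e]] := univ H (h \o s'); exists f; split=> // u.
by rewrite /= e /= sK.
Qed.

Lemma free_on_ord A (T : finType) (y : T -> F) :
  free_on A y -> exists z : 'I_#|T| -> F, free_on A z.
Proof.
move=> fy; exists (y \o enum_val); exact: free_on_reindex.
Qed.

End HomOn.

(** A subgroup as a group in its own right, so that universal properties
    stated for abstract groups can be applied to it. *)
Section SubgroupType.
Variables (F : groupType) (A : set F) (sA : subgroup A).

Definition subgroup_type : Type := let _ := sA in {x : F | x \in A}.
HB.instance Definition _ := Choice.on subgroup_type.

Definition subgroup_elt x (Ax : A x) : subgroup_type := exist _ x (mem_set Ax).

Lemma subgroup_typeP (u : subgroup_type) : A (val u).
Proof. by apply: set_mem; apply: (valP u). Qed.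

Definition subgroup_one := subgroup_elt (subgroup1 sA).
Definition subgroup_mul u v :=
  subgroup_elt (subgroupM sA (subgroup_typeP u) (subgroup_typeP v)).
Definition subgroup_inv u := subgroup_elt (subgroupV sA (subgroup_typeP u)).

Fact subgroup_mulA : associative subgroup_mul.
Proof. by move=> u v w; apply: val_inj; rewrite /= mulgA. Qed.
Fact subgroup_mul1g : left_id subgroup_one subgroup_mul.
Proof. by move=> u; apply: val_inj; rewrite /= mul1g. Qed.
Fact subgroup_mulg1 : right_id subgroup_one subgroup_mul.
Proof. by move=> u; apply: val_inj; rewrite /= mulg1. Qed.
Fact subgroup_mulVg : left_inverse subgroup_one subgroup_inv subgroup_mul.
Proof. by move=> u; apply: val_inj; rewrite /= mulVg. Qed.
Fact subgroup_mulgV : right_inverse subgroup_one subgroup_inv subgroup_mul.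
Proof. by move=> u; apply: val_inj; rewrite /= mulgV. Qed.

HB.instance Definition _ := isGroup.Build subgroup_type
  subgroup_mulA subgroup_mul1g subgroup_mulg1 subgroup_mulVg subgroup_mulgV.

End SubgroupType.

Section FreeBasis.
Variables (F : groupType) (I : Type) (X : I -> F).
Hypothesis freeX : free_basis X.

Lemma free_basis_hom (H : groupType) (h : I -> H) :
  exists f : F -> H, hom_on setT f /\ forall i, f (X i) = h i.
Proof.
have [f [fX _]] := freeX h; exists f; split=> // x y _ _; exact: gmulfM.
Qed.

Lemma free_basis_ext (H : groupType) (f g : F -> H) :
  hom_on setT f -> hom_on setT g -> (forall i, f (X i) = g (X i)) -> f =1 g.
Proof.
move=> hf hg e.
pose mk u (hu : hom_on setT u) : {multiplicative F -> H} :=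
  HB.pack u (isMultiplicative.Build F H u (fun x y => hu x y Logic.I Logic.I)).
have [k [_ uk]] := freeX (f \o X).
have ef := uk (mk f hf) (fun=> erefl).
have eg : (mk g hg : F -> H) =1 k by apply: uk => i; rewrite /= e.
by move=> x; rewrite -[g x]/(mk g hg x) -[f x]/(mk f hf x) ef eg.
Qed.

(** The homomorphism from F to the subgroup generated by the basis, followed by
    the inclusion, is the identity by the uniqueness part of the universal
    property. *)
Lemma free_basis_generates : generated (range X) = [set: F].
Proof.
have sX := generated_subgroup (range X).
have gX i : generated (range X) (X i) by apply: sub_generated; exists i.
have [f [hf fX]] := free_basis_hom (fun i => subgroup_elt sX (gX i)).
apply/seteqP; split=> // x _.
have -> : x = val (f x); last exact: subgroup_typeP.
apply: (@free_basis_ext F id (fun z => val (f z)) _ _ _ x) => // [a b _ _|i].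
  by rewrite hf.
by rewrite fX.
Qed.

Lemma free_basis_on : free_on setT X.
Proof.
split=> [|H h]; first by rewrite free_basis_generates.
exact: free_basis_hom.
Qed.

(** A basis element is detected by the homomorphism to the group of order two
    that it alone fails to kill, and such a homomorphism is determined by its
    values on a finite generating set. *)
Lemma free_basis_finite : finitely_generated F ->
  exists r (Y : 'I_r -> F) (s : 'I_r -> I), bijective s /\ Y = X \o s.
Proof.
case=> gs gsT.
pose h (i j : I) : 'I_2 := if `[< i = j >] then 1%R else 0%R.
pose f i := sval (cid (free_basis_hom (H := 'I_2) (h i))).
have fP i : hom_on setT (f i) /\ forall j, f i (X j) = h i j.
  exact: (svalP (cid (free_basis_hom (H := 'I_2) (h i)))).
pose e i : {ffun seq_sub gs -> 'I_2} := [ffun x => f i (val x)].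
have e_inj : injective e.
  move=> i j /ffunP eij.
  have fij : f i =1 f j.
    move=> x; apply: (@hom_on_ext _ _ [set` gs]); rewrite ?gsT//.
    - by have [] := fP i.
    - by have [] := fP j.
    move=> z zgs; have := eij (SeqSub zgs); by rewrite !ffunE.
  have := fij (X j); rewrite (fP i).2 (fP j).2 /h (asboolT (erefl j)).
  by case: asboolP.
pose K := {t : {ffun seq_sub gs -> 'I_2} | `[< exists i, e i = t >]}.
have kP (k : K) : exists i, e i = val k by apply/asboolP; apply: (valP k).
pose s k := sval (cid (kP k)).
have es k : e (s k) = val k by exact: (svalP (cid (kP k))).
have s_bij : bijective s.
  have iP i : `[< exists j, e j = e i >] by apply/asboolP; exists i.
  exists (fun i => exist _ (e i) (iP i)) => [k|i].
    by apply: val_inj; rewrite /= es.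
  by apply: e_inj; rewrite es.
exists #|{: K}|, (X \o (s \o enum_val)), (s \o enum_val); split=> //.
by apply: bij_comp => //; apply: enum_val_bij.
Qed.

End FreeBasis.

(** * Cosets and the index *)

Section Index.
Variable F : groupType.
Implicit Types A B : set F.

(** Right cosets are used because the group then acts on them from the right,
    which is the side on which permutations compose. *)
Definition coset_map A (T : finType) (w : F -> T) :=
  (forall t, exists x, w x = t) /\ (forall x y, w x = w y <-> A (x * y^-1)).

Definition has_index A n :=
  exists (T : finType) (w : F -> T), coset_map A w /\ #|T| = n.

Lemma coset_map_subgroup A (T : finType) (w : F -> T) :
  coset_map A w -> subgroup A.
Proof.
case=> _ wP; split; first by rewrite -(mulgV 1); apply/wP.
move=> x y Ax Ay; apply/wP; transitivity (w 1);
  first by apply/wP; rewrite invg1 mulg1.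
by apply/esym/wP; rewrite invg1 mulg1.
Qed.

Lemma has_index_subgroup A n : has_index A n -> subgroup A.
Proof. by case=> T [w [wA _]]; apply: coset_map_subgroup wA. Qed.

Lemma has_index_gt0 A n : has_index A n -> 0 < n.
Proof. by case=> T [w [_ <-]]; apply/card_gt0P; exists (w 1). Qed.

Lemma has_index_fi A n : has_index A n -> fi_subgroup A.
Proof.
move=> iA; have sA := has_index_subgroup iA; case: iA => T [w [[_ wP] _]].
split=> //; apply: (@finite_index_sep _ _ (fun x => w x^-1)) => //.
by move=> x y /wP; rewrite invgK.
Qed.

Lemma fi_has_index A : fi_subgroup A -> exists n, has_index A n.
Proof.
case=> sA /finite_seqP[s eA].
have ms x : lcoset A x^-1 \in s.
  have : range (lcoset A) (lcoset A x^-1) by exists x^-1.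
  by rewrite eA.
exists #|{: seq_sub s}|, (seq_sub s), (fun x => SeqSub (ms x)); split=> //;
  split.
  move=> [B Bs]; have : range (lcoset A) B by rewrite eA.
  by case=> x _ eB; exists x^-1; apply: val_inj; rewrite /= invgK.
move=> x y; split=> [[] /(lcoset_eqP sA)|Axy].
  by rewrite invgK.
apply: val_inj => /=; apply/seteqP; split=> _ [a Aa <-].
  exists (y * x^-1 * a); last by rewrite !mulgA mulVg mul1g.
  by apply: subgroupM => //; rewrite -(invgF x y); apply: subgroupV.
exists (x * y^-1 * a); last by rewrite !mulgA mulVg mul1g.
exact: subgroupM.
Qed.

Lemma has_indexT : has_index [set: F] 1.
Proof.
exists unit, (fun=> tt); split; last by rewrite card_unit.
by split=> // -[]; exists 1.
Qed.

Definition coset_rep A (T : finType) (w : F -> T) (wA : coset_map A w) t : F :=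
  sval (cid (wA.1 t)).

Lemma coset_repK A (T : finType) (w : F -> T) (wA : coset_map A w) t :
  w (coset_rep wA t) = t.
Proof. exact: (svalP (cid (wA.1 t))). Qed.

Lemma has_index_ker A n (gT : finGroupType) (P : {group gT}) (f : F -> gT) :
    has_index A n -> hom_on A f ->
    (forall x, A x -> f x \in P) ->
      (forall p, p \in P -> exists2 x, A x & f x = p) ->
  has_index (A `&` [set x | f x = 1]) (n * #|P|).
Proof.
move=> iA hf fP onto; have sA := has_index_subgroup iA.
case: iA => T [w [wA <-]].
have Arep x : A (x * (coset_rep wA (w x))^-1)
  by apply/(wA.2 _ _); rewrite coset_repK.
have mP x : f (x * (coset_rep wA (w x))^-1) \in P by apply: fP.
exists (T * subg_of P)%type,
  (fun x => (w x, subg P (f (x * (coset_rep wA (w x))^-1)))).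
split; last by rewrite card_prod card_sub.
split=> [[t u]|x y].
  have [a Aa ea] := onto _ (subgP u).
  exists (a * coset_rep wA t).
  have -> : w (a * coset_rep wA t) = t.
    by rewrite -[RHS](coset_repK wA); apply/(wA.2 _ _); rewrite mulgK.
  by rewrite mulgK ea sgvalK.
split=> [[exy /(congr1 (@sgval _ _))]|[Axy fxy]].
  rewrite !subgK// -exy => efxy.
  have Axy : A (x * y^-1) by apply/(wA.2 _ _).
  split=> //=; have -> : x * y^-1 = (x * (coset_rep wA (w x))^-1) *
     (y * (coset_rep wA (w x))^-1)^-1 by rewrite invgF mulgA mulgVK.
  have Ay : A (y * (coset_rep wA (w x))^-1) by rewrite exy.
  rewrite hf//; last exact: subgroupV.
  by rewrite (hom_onV sA hf)// efxy mulgV.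
have exy : w x = w y by apply/(wA.2 _ _).
congr pair => //; congr (subg P _); rewrite -exy.
set c := coset_rep wA (w x).
have -> : x * c^-1 = x * y^-1 * (y * c^-1) by rewrite mulgA mulgVK.
by rewrite hf ?fxy ?mul1g// /c exy.
Qed.

End Index.

Section CosetAction.
Variables (F : groupType) (A : set F) (T : finType) (w : F -> T).
Hypothesis wA : coset_map A w.

Let rep := coset_rep wA.
Definition coset_act t g := w (rep t * g).

Lemma coset_actE x g : coset_act (w x) g = w (x * g).
Proof.
apply/(wA.2 _ _); rewrite invgM !mulgA mulgK.
by apply/(wA.2 _ _); rewrite coset_repK.
Qed.

Lemma coset_act1 t : coset_act t 1 = t.
Proof. by rewrite /coset_act mulg1 coset_repK. Qed.

Lemma coset_actM t g h : coset_act t (g * h) = coset_act (coset_act t g) h.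
Proof. by have [x <-] := wA.1 t; rewrite !coset_actE mulgA. Qed.

Lemma coset_act_inj g : injective (coset_act^~ g).
Proof.
by apply: (can_inj (g := coset_act^~ g^-1)) => t;
  rewrite -coset_actM mulgV coset_act1.
Qed.

Definition coset_perm g : {perm T} := perm (@coset_act_inj g).

Lemma coset_perm_hom : hom_on setT coset_perm.
Proof.
by move=> g h _ _; apply/permP => t; rewrite permM !permE coset_actM.
Qed.

Lemma coset_act_base g : coset_act (w 1) g = w 1 <-> A g.
Proof.
by rewrite coset_actE mul1g; split=> [/(wA.2 _ _)|Ag];
  [|apply/(wA.2 _ _)]; rewrite invg1 mulg1.
Qed.

End CosetAction.

(** * The Nielsen-Schreier theorem *)

(** The permutational wreath product of H by the symmetric group of T. *)
Section Wreath.
Variables (T : finType) (H : groupType).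

Definition wreath : Type := ({ffun T -> H} * {perm T})%type.
HB.instance Definition _ := Choice.on wreath.

Definition wreath_one : wreath := ([ffun=> 1], 1).
Definition wreath_mul (u v : wreath) : wreath :=
  ([ffun t => u.1 t * v.1 (u.2 t)], u.2 * v.2).
Definition wreath_inv (u : wreath) : wreath :=
  ([ffun t => (u.1 (u.2^-1 t))^-1], u.2^-1).

Fact wreath_mulA : associative wreath_mul.
Proof.
move=> u v x; congr pair; last by rewrite /= mulgA.
by apply/ffunP => t; rewrite !ffunE /= ?ffunE ?permM mulgA.
Qed.
Fact wreath_mul1g : left_id wreath_one wreath_mul.
Proof.
move=> [u s]; congr pair; last by rewrite /= mul1g.
by apply/ffunP => t; rewrite !ffunE /= perm1 mul1g.
Qed.
Fact wreath_mulg1 : right_id wreath_one wreath_mul.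
Proof.
move=> [u s]; congr pair; last by rewrite /= mulg1.
by apply/ffunP => t; rewrite !ffunE /= mulg1.
Qed.
Fact wreath_mulVg : left_inverse wreath_one wreath_inv wreath_mul.
Proof.
move=> [u s]; congr pair; last by rewrite /= mulVg.
by apply/ffunP => t; rewrite !ffunE /= mulVg.
Qed.
Fact wreath_mulgV : right_inverse wreath_one wreath_inv wreath_mul.
Proof.
move=> [u s]; congr pair; last by rewrite /= mulgV.
by apply/ffunP => t; rewrite !ffunE /= permK mulgV.
Qed.

HB.instance Definition _ := isGroup.Build wreath
  wreath_mulA wreath_mul1g wreath_mulg1 wreath_mulVg wreath_mulgV.

End Wreath.

Section Schreier.
Variables (F : groupType) (r : nat) (X : 'I_r -> F).
Hypothesis freeX : free_on setT X.
Variables (A : set F) (T : finType) (w : F -> T).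
Hypothesis wA : coset_map A w.

Let act := coset_act wA.
Let t0 := w 1.

Definition cocycle (H : groupType) (b : T -> F -> H) :=
  forall t g h, b t (g * h) = b t g * b (act t g) h.

(** A homomorphism from F to the wreath product of H by Sym(T) that lifts the
    action on cosets is the same thing as a cocycle; freeness of F lets its
    values on the edges of the coset graph be prescribed. *)
Lemma cocycle_exists (H : groupType) (h : T * 'I_r -> H) :
  exists b : T -> F -> H, cocycle b /\ forall t i, b t (X i) = h (t, i).
Proof.
have [f [hf fX]] := freeX.2 (wreath T H)
  (fun i => ([ffun t => h (t, i)], coset_perm wA (X i))).
have f2 g : (f g).2 = coset_perm wA g.
  apply: (free_on_ext (f := fun g => (f g).2) freeX) => //.
  - by move=> x y _ _; rewrite hf.
  - exact: coset_perm_hom.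
  - by move=> i; rewrite fX.
exists (fun t g => (f g).1 t); split=> [t x y|t i]; last by rewrite fX /= ffunE.
by rewrite hf//= ffunE f2 permE.
Qed.

Lemma cocycle1 (H : groupType) (b : T -> F -> H) t : cocycle b -> b t 1 = 1.
Proof.
move=> cb; apply: (@mulgI H (b t 1)); rewrite mulg1.
by rewrite -{2}(coset_act1 wA t) -cb mulg1.
Qed.

Lemma cocycleV (H : groupType) (b : T -> F -> H) t g :
  cocycle b -> b (act t g) g^-1 = (b t g)^-1.
Proof. by move=> cb; apply/esym/mulg1_eq; rewrite -cb mulgV cocycle1. Qed.

(** A set of cosets closed under the forward edges of the coset graph is
    closed under the backward ones as well, since T is finite, hence is
    everything; so a tree that is not yet spanning can be enlarged. *)
Lemma forward_edge (S : {set T}) : t0 \in S -> S != [set: T]%SET ->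
  exists t i, t \in S /\ act t (X i) \notin S.
Proof.
move=> S0 neS; apply: contrapT => /forallNP noedge.
have closed t i : t \in S -> act t (X i) \in S.
  by move=> St; apply/negPn/negP => nS; apply: (noedge t); exists i.
suff stab g : coset_perm wA g \in 'N(S | 'P).
  case/eqP: neS; apply/setP => t; rewrite inE.
  have [x <-] := wA.1 t; have /astabs_act := stab x => /(_ t0).
  by rewrite S0 /= apermE permE coset_actE mul1g.
have [_] : [set x | [set: F] x /\ coset_perm wA x \in 'N(S | 'P)] g; last by [].
have : generated (range X) g by rewrite -freeX.1.
apply: generated_sub.
  exact: (subgroup_preim 'N(S | 'P)%G (@subgroupT F) (coset_perm_hom wA)).
move=> _ [i _ <-]; split=> //.
rewrite !inE /=; apply/fintype.subsetP => t St; rewrite inE /= apermE permE.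
exact: closed.
Qed.

(** The tree E is rooted at the base coset, and tau gives the elements of F
    read along its branches; the last property says that a cocycle trivial on
    the tree is trivial along the branches. *)
Lemma spanning_tree : exists (E : {set T * 'I_r}) (tau : T -> F),
  [/\ #|E|.+1 = #|T|, forall t, w (tau t) = t, tau t0 = 1,
      forall t i, (t, i) \in E -> tau t * X i = tau (act t (X i))
    & forall (H : groupType) (b : T -> F -> H), cocycle b ->
        (forall t i, (t, i) \in E -> b t (X i) = 1) ->
      forall t, b t0 (tau t) = 1].
Proof.
suff: forall k, k < #|T| ->
  exists (S : {set T}) (E : {set T * 'I_r}) (tau : T -> F),
  [/\ #|S| = k.+1 /\ #|E| = k, t0 \in S,
      (forall t, t \in S -> w (tau t) = t) /\ tau t0 = 1,
      forall t i, (t, i) \in E ->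
        [/\ t \in S, act t (X i) \in S & tau t * X i = tau (act t (X i))]
    & forall (H : groupType) (b : T -> F -> H), cocycle b ->
        (forall t i, (t, i) \in E -> b t (X i) = 1) ->
      forall t, t \in S -> b t0 (tau t) = 1].
  have T0 : 0 < #|T| by apply/card_gt0P; exists t0.
  move=> /(_ #|T|.-1); rewrite prednK// leqnn => /(_ isT)[S [E [tau]]].
  move=> [[cS cE] _ [wtau tau0] Etau tree].
  have ST : S = [set: T]%SET.
    by apply/eqP; rewrite eqEcard finset.subsetT cardsT cS leqnn.
  exists E, tau; split=> //; first by rewrite cE prednK.
  - by move=> t; apply: wtau; rewrite ST inE.
  - by move=> t i /Etau[].
  - by move=> H b cb bE t; apply: tree => //; rewrite ST inE.
elim=> [_|k IH kT].
  exists [set t0]%SET, finset.set0, (fun=> 1); split.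
  - by rewrite cards1 cards0.
  - by rewrite inE.
  - by split=> // t /set1P ->.
  - by move=> t i; rewrite finset.in_set0.
  - by move=> H b cb _ t _; apply: cocycle1.
have [S [E [tau [[cS cE] S0 [wtau tau0] Etau tree]]]] := IH (ltnW kT).
have neS : S != [set: T]%SET.
  by apply: contraTneq kT => ST; rewrite -ltnNge -cardsT -ST cS.
have [t [i [St nS]]] := forward_edge S0 neS.
set u := act t (X i) in nS.
have neq s : s \in S -> (s == u) = false.
  by move=> Ss; apply: contraNF nS => /eqP<-.
pose tau' s := if s == u then tau t * X i else tau s.
have tauS s : s \in S -> tau' s = tau s by move=> Ss; rewrite /tau' neq.
have tauu : tau' u = tau t * X i by rewrite /tau' eqxx.
exists (u |: S)%SET, ((t, i) |: E)%SET, tau'; split.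
- rewrite !cardsU1 cS cE nS.
  suff -> : (t, i) \notin E by [].
  by apply: contraNN nS => /Etau[].
- by rewrite !inE S0 orbT.
- rewrite tauS//; split=> // s /setU1P[->|Ss]; last by rewrite tauS// wtau.
  by rewrite tauu /u /act -[in RHS](wtau _ St) coset_actE.
- move=> s j /setU1P[[-> ->]|/Etau[Ss Sj e]].
    by rewrite tauS// !inE eqxx St orbT.
  by rewrite !tauS// !inE Ss Sj !orbT.
- move=> H b cb bE s.
  have bS : forall s, s \in S -> b t0 (tau s) = 1.
    by apply: tree => // s' j Ej; apply: bE; rewrite inE Ej orbT.
  case/setU1P => [->|Ss]; last by rewrite tauS// bS.
  rewrite tauu cb bS// mul1g /act coset_actE mul1g wtau//.
  by apply: bE; exact: setU11.
Qed.

(** The generators are the edges outside a spanning tree of the coset graph.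
    Prescribing values on them, and the value 1 on the tree, determines a
    cocycle, whose restriction to the stabiliser A of the base coset is the
    required homomorphism.  A spanning tree on n vertices has n - 1 edges,
    whence the rank n r - (n - 1). *)
Lemma Schreier : 0 < r ->
  exists y : 'I_(#|T| * r.-1).+1 -> F, free_on A y.
Proof.
move=> r_gt0; have [E [tau [cE wtau tau0 Etau tree]]] := spanning_tree.
pose edge (e : T * 'I_r) := tau e.1 * X e.2 * (tau (act e.1 (X e.2)))^-1.
have sA := coset_map_subgroup wA.
have tauA t g : A (tau t * g * (tau (act t g))^-1).
  by apply/(wA.2 _ _); rewrite wtau /act -(coset_actE wA) wtau.
(* A cocycle trivial along the branches takes on a Schreier generator the
   value that it takes on the corresponding edge. *)
have Vsc (H : groupType) (b : T -> F -> H) t g :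
    cocycle b -> (forall t, b t0 (tau t) = 1) ->
    b t0 (tau t * g * (tau (act t g))^-1) = b t g.
  move=> cb btau; rewrite -mulgA cb btau mul1g.
  have -> : act t0 (tau t) = t by rewrite /act coset_actE mul1g wtau.
  rewrite cb; set u := act t g.
  have eu : act t0 (tau u) = u by rewrite /act coset_actE mul1g wtau.
  have -> : b u (tau u)^-1 = b (act t0 (tau u)) (tau u)^-1 by rewrite eu.
  by rewrite cocycleV// btau invg1 mulg1.
pose J := {e : T * 'I_r | e \notin E}.
have cJ : #|{: J}| = (#|T| * r.-1).+1.
  have cC : #|[predC E]| + #|E| = (#|T| * r)%N
    by rewrite addnC cardC card_prod card_ord.
  have -> : #|{: J}| = #|[predC E]| by rewrite card_sig.
  have -> : #|[predC E]| = (#|T| * r - #|E|)%N by rewrite -cC addnK.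
  have -> : (#|T| * r = #|T| + #|T| * r.-1)%N by rewrite -mulnS prednK.
  by rewrite -{1}cE addSn subSn ?addKn// leq_addr.
pose y (e : J) := edge (val e).
have gens : A = generated (range y).
  apply/seteqP; split; last first.
    by apply: generated_sub => // _ [e _ <-]; apply: tauA.
  have sB := generated_subgroup (range y).
  have treeE t i : (t, i) \in E -> edge (t, i) = 1.
    by move=> /Etau e; rewrite /edge /= e mulgV.
  have BE t i : generated (range y) (edge (t, i)).
    have [Ee|nE] := boolP ((t, i) \in E);
      first by rewrite treeE//; apply: subgroup1.
    by apply: sub_generated; exists (exist _ (t, i) nE).
  pose C := [set g | forall t,
    generated (range y) (tau t * g * (tau (act t g))^-1)].
  have sC : subgroup C.
    split=> [t|g h Cg Ch t];
      first by rewrite /act coset_act1 mulg1 mulgV; apply: subgroup1.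
    set u := act t (g * h^-1).
    have eu : act u h = act t g by rewrite /act /u -coset_actM mulgVK.
    have := sB.2 _ _ (Cg t) (Ch u).
    rewrite eu invgF !mulgA mulgVK invgM !mulgA; by [].
  have CT g : C g.
    have : generated (range X) g by rewrite -freeX.1.
    by move: g; apply: generated_sub => // _ [i _ <-] t; apply: BE.
  move=> a Aa; have := CT a t0.
  have -> : act t0 a = t0 := (coset_act_base wA a).2 Aa.
  by rewrite tau0 mul1g invg1 mulg1.
have free : free_on A y.
  split=> // H h.
  pose h' e := if insub e is Some e' then h e' else 1.
  have [b [cb bX]] := cocycle_exists h'.
  have bE t i : (t, i) \in E -> b t (X i) = 1.
    by move=> Ee; rewrite bX /h' insubF// Ee.
  exists (b t0); split=> [g k Ag Ak|e].
    by rewrite cb; have -> : act t0 g = t0 := (coset_act_base wA g).2 Ag.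
  case: e => [[t i] nE]; rewrite /y /edge /= Vsc//;
    last by move=> s; apply: tree.
  by rewrite bX /h' insubT.
by have := free_on_ord free; rewrite cJ.
Qed.

End Schreier.

(** * Homomorphisms from free groups onto finite groups *)

Section FreeOn.
Variable F : groupType.
Implicit Types A B : set F.

(** A free group of rank n has 2 ^ n homomorphisms to the group of order two. *)
Lemma free_on_rank_leq A m n (y : 'I_m -> F) (z : 'I_n -> F) :
  free_on A y -> free_on A z -> m <= n.
Proof.
move=> fy fz.
pose f (h : {ffun 'I_m -> 'I_2}) := sval (cid (fy.2 'I_2 h)).
have fP h : hom_on A (f h) /\ forall t, f h (y t) = h t.
  exact: (svalP (cid (fy.2 'I_2 h))).
pose e h : {ffun 'I_n -> 'I_2} := [ffun j => f h (z j)].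
have e_inj : injective e.
  move=> h k /ffunP ehk; apply/ffunP => i.
  rewrite -(fP h).2 -(fP k).2;
    apply: (free_on_ext fz (fP h).1 (fP k).1) => [j|].
    by have := ehk j; rewrite !ffunE.
  exact: free_on_mem fy.
by have := leq_card e e_inj; rewrite !card_ffun !card_ord leq_exp2l.
Qed.

Lemma free_on_rank A m n (y : 'I_m -> F) (z : 'I_n -> F) :
  free_on A y -> free_on A z -> m = n.
Proof.
by move=> fy fz; apply/eqP;
  rewrite eqn_leq !(@free_on_rank_leq A _ _ y z, @free_on_rank_leq A _ _ z y).
Qed.

Lemma free_on_iso A B T (y z : T -> F) : free_on A y -> free_on B z ->
  exists th : F -> F,
    [/\ hom_on A th, set_bij A B th & forall t, th (y t) = z t].
Proof.
move=> fy fz; have [f [hf fE]] := fy.2 _ z; have [g [hg gE]] := fz.2 _ y.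
have maps C D u v (k : F -> F) : free_on C u -> free_on D v -> hom_on C k ->
    (forall t : T, k (u t) = v t) -> forall x, C x -> D (k x).
  move=> fu fv hk ke x Cx; have sC := free_on_subgroup fu;
    have sD := free_on_subgroup fv.
  have : C x by []; rewrite {1}fu.1 => Cx'.
  suff [] : [set x | C x /\ D (k x)] x by [].
  move: x Cx' {Cx}; apply: generated_sub => [|_ [t _ <-]]; last first.
    by split; [apply: free_on_mem fu|rewrite ke; apply: free_on_mem fv].
  split=> [|a b [Ca Da] [Cb Db]].
    by split; rewrite ?(hom_on1 sC hk); apply: subgroup1.
  split; first exact: sC.2.
  by rewrite hk ?(hom_onV sC hk)//; [apply: sD.2|apply: subgroupV].
have fM := maps _ _ _ _ _ fy fz hf fE; have gM := maps _ _ _ _ _ fz fy hg gE.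
have fK x : A x -> g (f x) = x.
  apply: (free_on_ext (f := g \o f) (g := id) fy) => // [a b Aa Ab|t].
    by rewrite /= hf// hg//; apply: fM.
  by rewrite /= fE gE.
have gK x : B x -> f (g x) = x.
  apply: (free_on_ext (f := f \o g) (g := id) fz) => // [a b Aa Ab|t].
    by rewrite /= hg// hf//; apply: gM.
  by rewrite /= gE fE.
exists f; split=> //; split=> //.
- move=> a b; rewrite !inE => Aa Ab /(congr1 g); by rewrite !fK.
- by move=> b Bb; exists (g b); [apply: gM|apply: gK].
Qed.

Lemma free_on_image A B T (y : T -> F) (th : F -> F) :
    subgroup B -> hom_on A th -> set_bij A B th -> free_on A y ->
  free_on B (th \o y).
Proof.
move=> sB hth [thB thI thS] fy; have sA := free_on_subgroup fy.
have sG := generated_subgroup (range (th \o y)).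
split.
  apply/seteqP; split; last first.
    apply: generated_sub => // _ [t _ <-]; apply: thB; exact: free_on_mem fy.
  move=> _ /thS[a Aa <-];
    suff [] : [set a | A a /\ generated (range (th \o y)) (th a)] a by [].
  move: a Aa; rewrite {1}fy.1; apply: generated_sub; last first.
    move=> _ [t _ <-]; split; first exact: free_on_mem fy.
    by apply: sub_generated; exists t.
  split=> [|a b [Aa Ga] [Ab Gb]].
    by split; rewrite ?(hom_on1 sA hth); apply: subgroup1.
  split; first exact: sA.2.
  rewrite hth//; last exact: subgroupV.
  by rewrite (hom_onV sA hth)//; apply: sG.2.
move=> H h; have [f [hf fE]] := fy.2 H h.
pose inv b := xget 1 [set a | A a /\ th a = b].
have invP b : B b -> A (inv b) /\ th (inv b) = b.
  by case/thS => a Aa e; apply: (@xgetPex _ 1 [set a | A a /\ th a = b]);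
    exists a.
have invK a : A a -> inv (th a) = a.
  move=> Aa; have [Ai e] := invP _ (thB _ Aa).
  by apply: thI; rewrite ?inE.
exists (f \o inv); split=> [b c Bb Bc|t] /=;
  last by rewrite invK ?fE//; apply: free_on_mem fy.
have [Ab eb] := invP _ Bb; have [Ac ec] := invP _ Bc.
rewrite -hf//; congr f; rewrite -{1}eb -{1}ec -hth// invK//.
exact: subgroupM.
Qed.

(** A simultaneous Nielsen move.  It is undone by the inverse multiplications,
    since the subgroup generated by the elements in S does not change. *)
Lemma free_on_modify A n (y : 'I_n -> F) (S : {set 'I_n}) (a : 'I_n -> F) :
    free_on A y ->
      (forall j, generated [set y i | i in [set i | i \in S]] (a j)) ->
  free_on A (fun j => if j \in S then y j else y j * a j).
Proof.
move=> fy aS; set z := fun j => _; have sA := free_on_subgroup fy.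
pose G := generated [set y i | i in [set i | i \in S]].
have sG : subgroup G by apply: generated_subgroup.
have zS i : i \in S -> z i = y i by rewrite /z => ->.
have zN i : i \notin S -> z i = y i * a i by rewrite /z => /negbTE->.
have sz := generated_subgroup (range z).
have sGA : G `<=` A.
  by apply: generated_sub => // _ [i _ <-]; apply: free_on_mem fy.
have sGz : G `<=` generated (range z).
  by apply: generated_sub => // _ [i Si <-]; rewrite -zS//;
    apply: sub_generated; exists i.
split.
  apply/seteqP; split; last first.
    apply: generated_sub => // _ [i _ <-]; rewrite /z;
      have Ay := free_on_mem i fy.
    by case: ifP => // _; apply: subgroupM => //; apply: sGA; apply: aS.
  rewrite {1}fy.1; apply: generated_sub => // _ [i _ <-].
  have zz : generated (range z) (z i) by apply: sub_generated; exists i.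
  have [Si|nSi] := boolP (i \in S); first by rewrite -zS.
  rewrite -[y i](mulgK (a i)) -zN//; apply: (subgroupM sz) => //.
  by apply: (subgroupV sz); apply: sGz; apply: aS.
move=> H h; have [f0 [hf0 f0E]] := fy.2 H h.
have [f [hf fE]] :=
  fy.2 H (fun j => if j \in S then h j else h j * (f0 (a j))^-1).
exists f; split=> // j; have [Sj|nSj] := boolP (j \in S).
  by rewrite zS// fE Sj.
have ff0 x : G x -> f x = f0 x.
  apply: hom_on_ext.
  - exact: hom_onS hf.
  - exact: hom_onS hf0.
  - by move=> _ [i Si <-]; rewrite fE f0E; move: Si => /= ->.
rewrite zN// hf; [|exact: free_on_mem fy|by apply: sGA; apply: aS].
by rewrite fE (negbTE nSj) ff0 ?mulgVK//; apply: aS.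
Qed.

End FreeOn.

Section Onto.
Variable F : groupType.
Implicit Types A B : set F.

Definition onto_on (gT : finGroupType) A (P : {set gT}) (f : F -> gT) :=
  [/\ hom_on A f, forall x, A x -> f x \in P
    & forall p, p \in P -> exists2 x, A x & f x = p].

Lemma image_group (gT : finGroupType) A (f : F -> gT) :
  subgroup A -> hom_on A f -> exists P : {group gT}, onto_on A P f.
Proof.
move=> sA hf; pose D := [set p | `[< exists2 x, A x & f x = p >]]%SET.
have gD : group_set D.
  apply/group_setP; split=> [|p q].
    rewrite finset.inE; apply/asboolP; exists 1; first exact: subgroup1.
    exact: hom_on1 hf.
  rewrite !finset.inE => /asboolP[a Aa ea] /asboolP[b Ab eb]; apply/asboolP.
  rewrite -ea -eb; by exists (a * b); [apply: (subgroupM sA)|apply: hf].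
exists (Group gD); split=> // [x Ax|p];
  first by rewrite finset.inE; apply/asboolP; exists x.
by rewrite finset.inE => /asboolP.
Qed.

Lemma onto_on_sub (gT : finGroupType) A (f : F -> gT) (P : {group gT}) T
    (y : T -> F)
    (Q : {group gT}) :
  onto_on A P f -> A = generated (range y) -> (forall t, f (y t) \in Q) ->
    P \subset Q.
Proof.
move=> [hf fP onto] eA fQ; apply/fintype.subsetP => p /onto[x Ax <-].
have sA : subgroup A by rewrite eA; apply: generated_subgroup.
suff [] : [set x | A x /\ f x \in Q] x by [].
move: x Ax; rewrite {1}eA; apply: generated_sub.
  exact: subgroup_preim.
by move=> _ [t _ <-]; split=> //; rewrite eA; apply: sub_generated; exists t.
Qed.

(** If the values on S generate P, a Nielsen move gives the other basis elements
    arbitrary values in P. *)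
Lemma retarget (gT : finGroupType) A n (y : 'I_n -> F) (f : F -> gT)
    (P : {group gT})
    (S : {set 'I_n}) (h : 'I_n -> gT) :
    free_on A y -> onto_on A P f -> P \subset <<(f \o y) @: S>> ->
    (forall j, h j \in P) ->
  exists z : 'I_n -> F, [/\ free_on A z, forall j, j \in S -> f (z j) = f (y j)
    & forall j, j \notin S -> f (z j) = h j].
Proof.
move=> fy [hf fP _] gS hP; have sA := free_on_subgroup fy.
have yA i : A (y i) := free_on_mem i fy.
pose G := generated [set y i | i in [set i | i \in S]].
have sGA : G `<=` A by apply: generated_sub => // _ [i _ <-].
have [Q [_ QG onto]] := image_group (generated_subgroup _) (hom_onS sGA hf).
have Qy i : i \in S -> f (y i) \in Q.
  by move=> Si; apply: QG; apply: sub_generated; exists i.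
have /choice[a aP] : forall j, exists a, G a /\ f a = (f (y j))^-1 * h j.
  move=> j; have : (f (y j))^-1 * h j \in Q.
    apply: (fintype.subsetP (fintype.subset_trans gS _)); last first.
      by rewrite groupM ?groupV ?hP ?fP.
    by rewrite gen_subG; apply/fintype.subsetP => _ /imsetP[i Si ->]; apply: Qy.
  by case/onto => x Gx e; exists x.
exists (fun j => if j \in S then y j else y j * a j); split.
- by apply: free_on_modify => // j; have [] := aP j.
- by move=> j ->.
- move=> j /negbTE->; have [Ga e] := aP j.
  by rewrite hf// ?e ?mulVKg//; apply: sGA.
Qed.

(** A target tuple h is reached in two moves when it still generates P without
    its entries in S: keep S while moving all the other entries to their target,
    then use these to correct S. *)
Lemma normalize_basis (gT : finGroupType) A n (y : 'I_n -> F) (f : F -> gT)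
    (P : {group gT}) (h : 'I_n -> gT) (S : {set 'I_n}) :
    free_on A y -> onto_on A P f -> (forall j, h j \in P) ->
    P \subset <<(f \o y) @: S>> -> P \subset <<h @: ~: S>> ->
  exists z : 'I_n -> F, free_on A z /\ forall j, f (z j) = h j.
Proof.
move=> fy fo hP gS gh.
have [z [fz _ zN]] := retarget fy fo gS hP.
have [|x [fx xN xS]] := retarget (S := ~: S) fz fo _ hP.
  apply: (fintype.subset_trans gh); rewrite genS//.
  apply/fintype.subsetP => _ /imsetP[i iS ->]; apply/imsetP; exists i => //.
  by rewrite /= zN//; move: iS; rewrite finset.inE.
exists x; split=> // j; have [Sj|nSj] := boolP (j \in S).
  by rewrite xS// inE negbK.
by rewrite xN ?inE// zN.
Qed.

(** Two crude sufficient conditions for n to be large enough with respect to P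
    that all homomorphisms from a free group of rank n onto P are isomorphic.
    The second one is needed because F itself may have rank two. *)
Definition ample_rank n (gT : finGroupType) (P : {set gT}) :=
  (#|P|.+1 * #|P| <= n) || (1 < n) && prime #|P|.

(** All homomorphisms onto P can be brought to the same standard tuple.  A
    generating tuple of P contains one with at most #|P| entries, and with a
    single entry when P has prime order, so the standard tuple has to be robust
    under the removal of as many entries. *)
Lemma standard_tuple (gT : finGroupType) n (P : {group gT}) :
    ample_rank n P ->
  exists h : 'I_n -> gT, (forall j, h j \in P) /\
    forall A (y : 'I_n -> F) (f : F -> gT), free_on A y -> onto_on A P f ->
      exists z : 'I_n -> F, free_on A z /\ forall j, f (z j) = h j.
Proof.
case/orP => [big|/andP[n1 pr]].
  (* Every element of P occurs at least #|P| + 1 times in h. *)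
  pose h (j : 'I_n) := nth 1 (enum P) (j %% #|P|).
  have P0 : 0 < #|P| := cardG_gt0 P.
  have hP j : h j \in P by rewrite -mem_enum mem_nth// -cardE ltn_mod.
  exists h; split=> // A y f fy fo; have [_ fP _] := fo.
  have i0 : 'I_n by exists 0; apply: leq_trans big; rewrite muln_gt0.
  pose c p := odflt i0 [pick i | f (y i) == p].
  apply: (normalize_basis (S := c @: P) fy fo) => //.
    apply: (onto_on_sub fo fy.1) => i; apply: mem_gen; apply/imsetP;
      exists (c (f (y i))).
      apply: imset_f; apply: fP; exact: free_on_mem fy.
    by rewrite /c /=; case: pickP => [k /eqP->|/(_ i)]//; rewrite eqxx.
  apply/fintype.subsetP => p Pp.
  have bq : index p (enum P) < #|P| by rewrite cardE index_mem mem_enum.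
  have lt_n (a : 'I_(#|P|.+1)) : a * #|P| + index p (enum P) < n.
    apply: leq_trans big; apply: leq_trans (_ : a.+1 * #|P| <= _).
      by rewrite mulSn addnC ltn_add2r.
    by rewrite leq_mul2r ltn_ord orbT.
  (* The positions of #|P| + 1 occurrences of p in h. *)
  pose e a := Ordinal (lt_n a).
  have e_inj : injective e.
    move=> a b /(congr1 val)/= /eqP; rewrite eqn_add2r eqn_pmul2r// => /eqP.
    exact: val_inj.
  have /fintype.subsetPn[i /imsetP[a _ ->] ni] : ~~
    ([set e a | a in 'I_(#|P|.+1)]%SET \subset c @: P).
    apply/negP => /subset_leq_card; rewrite card_imset// card_ord.
    by move=> /leq_trans/(_ (leq_imset_card _ _)); rewrite ltnn.
  apply: mem_gen; apply/imsetP; exists (e a); rewrite ?finset.inE//.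
  by rewrite /h /= modnMDl modn_small// nth_index// mem_enum.
have [p Pp np] : exists2 p, p \in P & p != 1.
  by apply/trivgPn; rewrite -cardG_gt1; apply: prime_gt1.
have genP q : q \in P -> q != 1 -> P \subset <<[set q]%SET>>.
  move=> Pq nq; rewrite -[<<_>>]/<[q]>.
  suff -> : <[q]> = P by [].
  apply/eqP; rewrite eqEcard cycle_subG Pq /=.
  suff /(prime_nt_dvdP pr) : #[q] %| #|P|
    by rewrite order_eq1 => /(_ nq); rewrite /order => ->.
  exact: order_dvdG.
(* The constant tuple generates P as soon as one entry is left. *)
exists (fun=> p); split=> // A y f fy fo; have [_ fP _] := fo.
have [i ni] : exists i, f (y i) != 1.
  apply: contrapT => /forallNP all1.
  have : P \subset 1%G.
    by apply: (onto_on_sub fo fy.1) => i; rewrite inE; apply/negPn/negP/all1.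
  by move=> /fintype.subsetP/(_ _ Pp); rewrite inE; apply/negP.
apply: (normalize_basis (S := [set i]%SET) fy fo) => //.
  by rewrite imset_set1; apply: genP => //; apply: fP; apply: free_on_mem fy.
have [j ji] : exists j, j != i.
  have [->|ni0] := eqVneq i (Ordinal n1); first by exists (Ordinal (ltnW n1)).
  by exists (Ordinal n1); rewrite eq_sym.
apply: fintype.subset_trans (genP _ Pp np) _; rewrite genS//.
by rewrite finset.sub1set; apply/imsetP; exists j; rewrite ?finset.inE.
Qed.

(** Bring both homomorphisms to the same tuple of values by changing the bases,
    and match the new bases. *)
Lemma onto_on_unique (gT : finGroupType) n (P : {group gT}) A B
    (y z : 'I_n -> F)
    (f g : F -> gT) :
    ample_rank n P -> free_on A y -> free_on B z -> onto_on A P f ->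
      onto_on B P g ->
  exists th : F -> F,
    [/\ hom_on A th, set_bij A B th & forall x, A x -> g (th x) = f x].
Proof.
move=> /standard_tuple[h [_ std]] fy fz fo go.
have [y' [fy' yh]] := std _ _ _ fy fo; have [z' [fz' zh]] := std _ _ _ fz go.
have [th [hth bth thE]] := free_on_iso fy' fz'; exists th; split=> //.
have [hf _ _] := fo; have [hg _ _] := go; have [thB _ _] := bth.
apply: (free_on_ext (f := g \o th) fy') => // [a b Aa Ab|t].
  by rewrite /= hth// hg//; apply: thB.
by rewrite /= thE zh yh.
Qed.

Lemma onto_on_exists (gT : finGroupType) n (P : {group gT}) A (y : 'I_n -> F) :
  free_on A y -> #|P| <= n -> exists f : F -> gT, onto_on A P f.
Proof.
move=> fy Pn; have sA := free_on_subgroup fy.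
have [f [hf fE]] := fy.2 gT (fun i => nth 1 (enum P) i).
have fP x : A x -> f x \in P.
  rewrite {1}fy.1 => Ax; suff [] : [set x | A x /\ f x \in P] x by [].
  move: x Ax; apply: generated_sub; first exact: subgroup_preim.
  move=> _ [t _ <-]; split; first exact: free_on_mem fy.
  rewrite fE; have [lt|ge] := ltnP t (size (enum P));
    last by rewrite nth_default.
  by rewrite -mem_enum mem_nth.
exists f; split=> // p Pp.
have bq : index p (enum P) < #|P| by rewrite cardE index_mem mem_enum.
exists (y (Ordinal (leq_trans bq Pn))); first exact: free_on_mem fy.
by rewrite fE /= nth_index// mem_enum.
Qed.

Lemma onto_on_index A n (gT : finGroupType) (P : {group gT}) (f : F -> gT) :
  has_index A n -> onto_on A P f ->
    has_index (A `&` [set x | f x = 1]) (n * #|P|).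
Proof. by move=> iA [hf fP onto]; apply: has_index_ker. Qed.

Lemma fi_ker A (gT : finGroupType) (f : F -> gT) :
  fi_subgroup A -> hom_on A f -> fi_subgroup (A `&` [set x | f x = 1]).
Proof.
move=> fA hf; have [P Pf] := image_group fA.1 hf;
  have [n iA] := fi_has_index fA.
exact: has_index_fi (onto_on_index iA Pf).
Qed.

End Onto.

(** * Virtual isomorphisms and the normality of AComm *)

Section Restrict.
Variable F : groupType.
Implicit Types A B C : set F.
Implicit Types f g : viso F.

Lemma viso_hom f : hom_on (vdom f) (vfun f).
Proof. by move=> x y fx fy; apply: vfunM; rewrite inE. Qed.

Lemma viso_exists A B (th : F -> F) :
    fi_subgroup A -> fi_subgroup B -> hom_on A th -> set_bij A B th ->
  exists f, [/\ vdom f = A, vcod f = B & vfun f = th].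
Proof.
move=> fA fB hth bth.
have thM : {in A &, {morph th : x y / x * y}}
  by move=> x y; rewrite !inE; apply: hth.
by exists (VIso fA fB thM bth).
Qed.

Lemma vinvfun_hom f : hom_on (vcod f) (vinvfun f).
Proof. by move=> x y fx fy; apply: vinvfunM; rewrite inE. Qed.

Lemma fi_subgroup_preim_on A D (f : F -> F) :
  fi_subgroup A -> hom_on A f -> fi_subgroup D -> fi_subgroup (A `&` f @^-1` D).
Proof.
move=> fA hf fD; apply: fi_subgroup_preim => // x y; rewrite !inE; exact: hf.
Qed.

Lemma viso_image_fi f A : fi_subgroup A -> A `<=` vdom f ->
  fi_subgroup (vfun f @` A).
Proof.
move=> fA Af; suff -> : vfun f @` A = vcod f `&` vinvfun f @^-1` A.
  by apply: fi_subgroup_preim_on => //; [apply: vcodP|apply: vinvfun_hom].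
apply/seteqP; split=> [_ [x Ax <-]|y [fy Ay]].
  by have fx := Af _ Ax; split; [apply: vfun_dom|rewrite /= vinvfunK].
by have [_ e] := vinvfunP fy; exists (vinvfun f y).
Qed.

Lemma viso_restrict f A : fi_subgroup A -> A `<=` vdom f ->
  exists g, [/\ vdom g = A, vcod g = vfun f @` A, vfun g = vfun f
    & comm_class g = comm_class f].
Proof.
move=> fA Af; have fB := viso_image_fi fA Af.
have bij : set_bij A (vfun f @` A) (vfun f).
  split; [by move=> x Ax; exists x| |by []].
  by move=> x y; rewrite !inE => /Af fx /Af fy; exact: vfun_inj.
have [g [dg cg eg]] := viso_exists fA fB (hom_onS Af (@viso_hom f)) bij.
exists g; split=> //; apply/comm_classP; exists A; rewrite dg eg; split=> //.
Qed.

Lemma comm_class_surj (c : Comm F) : exists f, comm_class f = c.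
Proof. exact: ex_intro (comm_class_repr c). Qed.

End Restrict.

Section Normal.
Variables (F : groupType) (r : nat) (X : 'I_r -> F).
Hypotheses (freeX : free_on setT X) (r_gt0 : 0 < r).
Implicit Types A B C : set F.

Lemma index_free A n : has_index A n ->
  exists y : 'I_(n * r.-1).+1 -> F, free_on A y.
Proof. by move=> [T [w [wA <-]]]; exact: (Schreier freeX wA r_gt0). Qed.

(** The common kernel of all homomorphisms from A to a fixed finite group is a
    characteristic subgroup, and has finite index because A is finitely
    generated.  Taking for the finite group the permutations of the cosets of C
    puts it inside C. *)
Lemma characteristic_subgroup A C : fi_subgroup A -> fi_subgroup C ->
  C `<=` A ->
  exists B, [/\ fi_subgroup B, B `<=` C & forall f : viso F,
    vdom f = A -> vcod f = A -> forall x, B x -> B (vfun f x)].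
Proof.
move=> fA fC sCA; have [n iA] := fi_has_index fA; have [y fy] := index_free iA.
have [m [T [w [wC _]]]] := fi_has_index fC.
pose gT := {perm T}.
pose B := [set x | A x /\ forall k : F -> gT, hom_on A k -> k x = 1].
exists B; split.
- pose k (h : {ffun 'I_(n * r.-1).+1 -> gT}) := sval (cid (fy.2 gT h)).
  have kP h : hom_on A (k h) /\ forall t, k h (y t) = h t.
    exact: (svalP (cid (fy.2 gT h))).
  pose K x : {dffun forall h : {ffun 'I_(n * r.-1).+1 -> gT}, gT} :=
    [ffun h => k h x].
  have hK : hom_on A K.
    by move=> a b Aa Ab; apply/ffunP => h; rewrite !ffunE (kP h).1.
  suff -> : B = A `&` [set x | K x = 1] by apply: (fi_ker fA hK).
  apply/seteqP; split=> [x [Ax xB]|x [Ax /ffunP xK]]; split=> //.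
    by apply/ffunP => h; rewrite !ffunE; apply: xB; case: (kP h).
  move=> u hu; pose h := [ffun i => u (y i)] : {ffun 'I_(n * r.-1).+1 -> gT}.
  have -> : u x = k h x.
    by apply: (free_on_ext fy hu (kP h).1) => // i; rewrite (kP h).2 ffunE.
  by have := xK h; rewrite !ffunE.
- move=> x [Ax /(_ (coset_perm wC))]; have hc := coset_perm_hom wC.
  move=> /(_ (hom_onS (@subsetT _ A) hc)) e; apply/(coset_act_base wC).
  by have := congr1 (fun s : {perm T} => s (w 1)) e; rewrite permE perm1.
- move=> f df cf x [Ax Bx]; split;
  first by rewrite -cf; apply: vfun_dom; rewrite df.
  move=> k hk; apply: (Bx (k \o vfun f)) => a b Aa Ab /=.
  rewrite viso_hom ?df// hk//; by rewrite -cf; apply: vfun_dom; rewrite df.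
Qed.

(** A conjugate of an automorphism a of A by ph is an automorphism of the
    preimage under ph of a characteristic subgroup of A contained in the
    codomain of ph. *)
Lemma aut_classes_conj (s y : Comm F) :
  (\bigcup_(A in @fi_subgroup F) aut_classes A) s ->
  (\bigcup_(A in @fi_subgroup F) aut_classes A) (s ^ y).
Proof.
move=> [A fA [a [da ca] <-]]; have [ph <-] := comm_class_surj y.
have fC : fi_subgroup (A `&` vcod ph)
  by apply: fi_subgroupI => //; apply: vcodP.
have [B [fB BC Bchar]] := characteristic_subgroup fA fC (@subIsetl _ _ _).
have Ba x : B x -> B (vfun a x) by apply: Bchar.
have Bai x : B x -> B (vinvfun a x) by apply: (Bchar (vinv a)).
have BA x : B x -> A x by case/BC.
have Bp x : B x -> vcod ph x by case/BC.
pose D := vdom ph `&` vfun ph @^-1` B.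
have fD : fi_subgroup D.
  by apply: fi_subgroup_preim_on => //; [apply: vdomP|apply: viso_hom].
pose k x := vinvfun ph (vfun a (vfun ph x)).
have pK x : B x -> vdom ph (vinvfun ph x) /\ vfun ph (vinvfun ph x) = x.
  by move=> /Bp; apply: vinvfunP.
have Dk x : D x -> D (k x).
  move=> [px Bx]; have [d e] := pK _ (Ba _ Bx).
  by split=> //; rewrite /= /k e; apply: Ba.
have hk : hom_on D k.
  move=> x z [px Bx] [pz Bz]; rewrite /k viso_hom// viso_hom ?da; try exact: BA.
  by rewrite vinvfun_hom//; apply: Bp; apply: Ba.
have bk : set_bij D D k.
  split=> //.
  - move=> x z; rewrite !inE => -[px Bx] [pz Bz] /(congr1 (vfun ph)).
    rewrite /k (pK _ (Ba _ Bx)).2 (pK _ (Ba _ Bz)).2 => /vfun_inj.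
    by rewrite da => /(_ (BA _ Bx) (BA _ Bz)) /vfun_inj; apply.
  - move=> x [px Bx]; have Bv := Bai _ Bx; have [d e] := pK _ Bv.
    exists (vinvfun ph (vinvfun a (vfun ph x)));
      first by split=> //; rewrite /= e.
    have [|_ e'] := @vinvfunP _ a (vfun ph x); first by rewrite ca; apply: BA.
    by rewrite /k e e' vinvfunK.
have [g [dg cg eg]] := viso_exists fD fD hk bk.
exists D => //; exists g; first by split.
rewrite /conjg -[_^-1]/(comm_inv _) -![_ * _]/(comm_mul _ _) comm_invE
  !comm_mulE.
apply/comm_classP; exists D; rewrite dg; split=> // [x [px Bx]|x Dx];
  last by rewrite eg.
split; first by split=> //; split; [apply: Bp|rewrite da; apply: BA].
split; last by apply: Bp; apply: Ba.
by exists (vfun ph x) => //; split; [apply: Bp|rewrite da; apply: BA].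
Qed.

Lemma AComm_normal : normal_subgroup (AComm F).
Proof.
have sG := generated_subgroup (\bigcup_(A in @fi_subgroup F) aut_classes A).
split=> // s y; rewrite /AComm => Gs.
suff: (fun s => AComm F (s ^ y)) s by [].
move: s Gs; apply: generated_sub => [|s Ss]; last first.
  by apply: sub_generated; apply: aut_classes_conj.
split=> [|s t Gs Gt]; first by rewrite conj1g; apply: subgroup1.
by rewrite conjMg conjVg; apply: sG.2.
Qed.

End Normal.

(** * Reference subgroups with cyclic quotient *)

(** The additive group of integers in multiplicative notation. *)
Definition zgroup : Type := int.
HB.instance Definition _ := Choice.on zgroup.

Fact zgroup_addA : associative (@GRing.add int : zgroup -> zgroup -> zgroup).
Proof. exact: GRing.addrA. Qed.
Fact zgroup_add0 : left_id (0%R : zgroup)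
    (@GRing.add int : zgroup -> zgroup -> zgroup).
Proof. exact: GRing.add0r. Qed.
Fact zgroup_addr0 : right_id (0%R : zgroup)
    (@GRing.add int : zgroup -> zgroup -> zgroup).
Proof. exact: GRing.addr0. Qed.
Fact zgroup_addN :
  left_inverse (0%R : zgroup) (@GRing.opp int : zgroup -> zgroup)
    (@GRing.add int : zgroup -> zgroup -> zgroup).
Proof. exact: GRing.addNr. Qed.
Fact zgroup_addrN :
  right_inverse (0%R : zgroup) (@GRing.opp int : zgroup -> zgroup)
    (@GRing.add int : zgroup -> zgroup -> zgroup).
Proof. exact: GRing.addrN. Qed.

HB.instance Definition _ := isGroup.Build zgroup
  zgroup_addA zgroup_add0 zgroup_addr0 zgroup_addN zgroup_addrN.

Lemma Zp_intmul_eq0 m (z : int) :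
  ((Zp1 : 'I_m.+1) *~ z == 0)%R = (Posz m.+1 %| z)%Z.
Proof.
have nat0 k : ((Zp1 : 'I_m.+1) *+ k == 0)%R = (m.+1 %| k)%N.
  by rewrite Zp_mulrn -val_eqE /= modnMml mul1n.
case: z => k; first by rewrite -pmulrn nat0.
by rewrite NegzE mulrNz GRing.oppr_eq0 -pmulrn nat0 dvdzE abszN.
Qed.

Section CyclicCovers.
Variables (F : groupType) (r : nat) (X : 'I_r -> F).
Hypotheses (freeX : free_on setT X) (r_gt1 : 1 < r).

Definition exponent_sum : F -> int :=
  sval (cid (freeX.2 zgroup (fun=> 1%R : zgroup))).
Local Notation e := exponent_sum.

Lemma exponent_sumM g h : e (g * h) = (e g + e h)%R.
Proof.
by have [+ _] := svalP (cid (freeX.2 zgroup (fun=> 1%R : zgroup))); apply.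
Qed.

Lemma exponent_sumX i : e (X i) = 1%R.
Proof.
by have [_] := svalP (cid (freeX.2 zgroup (fun=> 1%R : zgroup))); apply.
Qed.

Lemma exponent_sum1 : e 1 = 0%R.
Proof.
by apply: (@GRing.addrI _ (e 1)); rewrite -exponent_sumM mulg1 GRing.addr0.
Qed.

Lemma exponent_sumXn i k : e (X i ^+ k) = Posz k.
Proof.
elim: k => [|k IH]; first exact: exponent_sum1.
by rewrite expgS exponent_sumM exponent_sumX IH -PoszD add1n.
Qed.

(** The reference subgroup of index n: these subgroups are nested according to
    divisibility, with cyclic quotients. *)
Definition cyclic_sub n : set F := [set g | (Posz n %| e g)%Z].

Definition cyclic_quo i m (g : F) : 'I_m.+1 :=
  ((Zp1 : 'I_m.+1) *~ (e g %/ Posz i)%Z)%R.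

Lemma cyclic_sub1 : cyclic_sub 1 = setT.
Proof. by apply/seteqP; split=> // g _; rewrite /cyclic_sub /= dvd1z. Qed.

Lemma cyclic_quo_hom i m : hom_on (cyclic_sub i) (cyclic_quo i m).
Proof.
move=> g h Cg Ch; by rewrite /cyclic_quo exponent_sumM (divzDl _ Cg) mulrzDr.
Qed.

Lemma cyclic_quo_onto i m : 0 < i -> onto_on (cyclic_sub i) [set: 'I_m.+1]%SET
    (cyclic_quo i m).
Proof.
move=> i_gt0; split; [exact: cyclic_quo_hom|by move=> g _; rewrite finset.inE|].
move=> p _; have i0 : 'I_r by exists 0; apply: ltnW.
exists (X i0 ^+ (i * p)).
  by rewrite /cyclic_sub /= exponent_sumXn PoszM dvdz_mulr.
rewrite /cyclic_quo exponent_sumXn PoszM mulKz; last by rewrite -lt0n.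
by rewrite -pmulrn Zp_mulrn; apply: val_inj;
  rewrite /= modnMml mul1n modn_small.
Qed.

Lemma cyclic_quo_ker i m : 0 < i ->
  cyclic_sub i `&` [set g | cyclic_quo i m g = 1] = cyclic_sub (i * m.+1).
Proof.
move=> i_gt0; apply/seteqP; split=> g /=.
  move=> [Cg /eqP]; rewrite Zp_intmul_eq0 /cyclic_sub /= PoszM => Cq.
  by rewrite -(divzK Cg) GRing.mulrC dvdz_mul.
rewrite /cyclic_sub /= PoszM => Cg; have Ci : (Posz i %| e g)%Z.
  by apply: dvdz_trans Cg; apply: dvdz_mulr.
split=> //; apply/eqP; rewrite Zp_intmul_eq0.
by rewrite -(@dvdz_mul2r (Posz i)) ?divzK// 1?GRing.mulrC// -lt0n.
Qed.

Lemma cyclic_sub_index n : 0 < n -> has_index (cyclic_sub n) n.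
Proof.
case: n => // n _;
  have := onto_on_index (P := [set: 'I_n.+1]%G) _
    (cyclic_quo_onto n (ltn0Sn 0)).
by rewrite cyclic_quo_ker// mul1n cyclic_sub1 => /(_ _ (@has_indexT F));
  rewrite cardsT card_ord mul1n.
Qed.

End CyclicCovers.

(** * Coordinates of subgroups of finite index *)

Section Calculus.
Variables (F : groupType) (r : nat) (X : 'I_r -> F).
Hypotheses (freeX : free_on setT X) (r_gt1 : 1 < r)
    (nA : normal_subgroup (AComm F)).
Implicit Types A B C : set F.
Implicit Types f g h : viso F.

Let r_gt0 : 0 < r := ltnW r_gt1.
Local Notation Q := (quotient_group nA).

Definition quo_class f : Q := quo nA (comm_class f).

Lemma quo_class_surj (q : Q) : exists f, quo_class f = q.
Proof.
have [f ef] := comm_class_surj (generic_quotient.repr q).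
by exists f; rewrite /quo_class ef quo_repr.
Qed.

Lemma quo_class_comp f g : vcod f = vdom g ->
  exists h, [/\ vdom h = vdom f, vcod h = vcod g & quo_class h =
    quo_class g * quo_class f].
Proof.
move=> e; exists (vcomp g f); split.
- apply/seteqP; split=> x; first by case.
  by move=> fx; have fx' := vfun_dom fx; split=> //; split=> //; rewrite -e.
- apply/seteqP; split=> [_ [y [_ gy] <-]|y gy]; first exact: vfun_dom.
  have [gx ey] := vinvfunP gy; exists (vinvfun g y) => //.
  by split=> //; rewrite e.
- by rewrite /quo_class -comm_mulE -[RHS]/(quo_mul _ _) quo_mulE.
Qed.

Lemma quo_class_inv f : quo_class (vinv f) = (quo_class f)^-1.
Proof.
by rewrite /quo_class -[RHS]/(quo_inv _) quo_invE
  -[X in _ = quo _ X]/(comm_inv _) comm_invE.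
Qed.

Lemma quo_class_aut f : vdom f = vcod f -> quo_class f = 1.
Proof.
move=> e; suff e1 : quo nA 1 = quo nA (comm_class f) by exact: esym e1.
apply/quoP; rewrite invg1 mul1g; apply: sub_generated.
by exists (vdom f); [apply: vdomP|exists f].
Qed.

Lemma quo_class_unique f g : vdom f = vdom g -> vcod f = vcod g ->
  quo_class f = quo_class g.
Proof.
move=> ed ec; have [h [hd hc eh]] := @quo_class_comp f (vinv g) ec.
apply/esym/(mulgI (quo_class g)^-1);
  rewrite mulVg -quo_class_inv -eh quo_class_aut//.
by rewrite hd hc.
Qed.

Lemma quo_class_restrict f A : fi_subgroup A -> A `<=` vdom f ->
  exists g, [/\ vdom g = A, vcod g = vfun f @` A, vfun g = vfun f &
    quo_class g = quo_class f].
Proof.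
move=> fA Af; have [g [gd gc ge gf]] := viso_restrict fA Af.
by exists g; split=> //; rewrite /quo_class gf.
Qed.

(** The index of a subgroup is determined by its rank, because F has rank at
    least two. *)
Lemma viso_index f m n : has_index (vdom f) m -> has_index (vcod f) n -> m = n.
Proof.
move=> /(index_free freeX r_gt0)[y fy] /(index_free freeX r_gt0)[z fz].
have fz' : free_on (vcod f) (vfun f \o y).
  exact: free_on_image (vcodP f).1 (@viso_hom _ f) (vfun_bij f) fy.
have /eqP := free_on_rank fz fz'.
by rewrite eqSS eqn_pmul2r ?ltn_predRL// => /eqP.
Qed.

Lemma index_viso A B n : has_index A n -> has_index B n ->
  exists f, vdom f = A /\ vcod f = B.
Proof.
move=> iA iB; have [y fy] := index_free freeX r_gt0 iA.
have [z fz] := index_free freeX r_gt0 iB.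
have [th [hth bth _]] := free_on_iso fy fz.
have [f [df cf _]] := viso_exists (has_index_fi iA) (has_index_fi iB) hth bth.
by exists f.
Qed.

Local Notation cyclic_sub := (cyclic_sub freeX).

(** The common class of the isomorphisms from the reference subgroup of the same
    index to A. *)
Definition fi_coord A : Q :=
  xget 1 [set q | exists f n,
    [/\ 0 < n, vdom f = cyclic_sub n, vcod f = A & quo_class f = q]].

Lemma fi_coordE f n : 0 < n -> vdom f = cyclic_sub n -> fi_coord (vcod f) =
  quo_class f.
Proof.
move=> n_gt0 df; rewrite /fi_coord;
  case: xgetP => [_ -> [g [m [m_gt0 dg cg <-]]]|].
  apply: quo_class_unique => //; rewrite df dg; congr (cyclic_sub _).
  have ic k : 0 < k -> has_index (cyclic_sub k) k by apply: cyclic_sub_index.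
  have [k ik] := fi_has_index (vcodP f).
  have -> : m = k by apply: (@viso_index g); rewrite ?dg ?cg//; apply: ic.
  by apply/esym/(@viso_index f); rewrite ?df//; apply: ic.
by move=> /(_ (quo_class f)) []; exists f, n.
Qed.

Lemma fi_coord_cyclic n : 0 < n -> fi_coord (cyclic_sub n) = 1.
Proof.
move=> n_gt0; have ic := cyclic_sub_index freeX r_gt1 n_gt0.
have [f [df cf]] := index_viso ic ic.
by rewrite -{1}cf (fi_coordE n_gt0 df) quo_class_aut// df.
Qed.

Lemma quo_class_coord f : quo_class f = fi_coord (vcod f) *
    (fi_coord (vdom f))^-1.
Proof.
have [n iA] := fi_has_index (vdomP f); have n_gt0 := has_index_gt0 iA.
have [g [dg cg]] := index_viso (cyclic_sub_index freeX r_gt1 n_gt0) iA.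
have [h [dh ch eh]] := quo_class_comp cg.
by rewrite -ch (fi_coordE n_gt0 (etrans dh dg)) -cg
  (fi_coordE n_gt0 dg) eh mulgK.
Qed.

(** The relative coordinate of a pair of nested subgroups only depends on the
    isomorphism class of the pair: f multiplies both coordinates on the left by
    its own class. *)
Lemma fi_coord_ratio f A : fi_subgroup A -> A `<=` vdom f ->
  (fi_coord (vdom f))^-1 * fi_coord A =
    (fi_coord (vcod f))^-1 * fi_coord (vfun f @` A).
Proof.
move=> fA Af; have [g [gd gc _ eg]] := quo_class_restrict fA Af.
have e1 := quo_class_coord f; have e2 := quo_class_coord g.
have -> : fi_coord (vfun f @` A) = quo_class f * fi_coord A
  by rewrite -eg e2 gd gc mulgVK.
by rewrite e1 !mulgA mulVg mul1g.
Qed.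

Definition kernel (gT : finGroupType) A (k : F -> gT) :=
  A `&` [set x | k x = 1].

Lemma fi_coord_ker (gT : finGroupType) (P : {group gT}) A B n (k l : F -> gT) :
    has_index A n -> has_index B n -> ample_rank (n * r.-1).+1 P ->
    onto_on A P k -> onto_on B P l ->
  (fi_coord A)^-1 * fi_coord (kernel A k) =
    (fi_coord B)^-1 * fi_coord (kernel B l).
Proof.
move=> iA iB mP ok ol.
have [y fy] := index_free freeX r_gt0 iA;
  have [z fz] := index_free freeX r_gt0 iB.
have [th [hth bth e]] := onto_on_unique mP fy fz ok ol.
have [f [df cf ef]] := viso_exists (has_index_fi iA) (has_index_fi iB) hth bth.
have fK := has_index_fi (onto_on_index iA ok).
have := @fi_coord_ratio f _ fK; rewrite df cf ef => ->; last by move=> x [].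
congr (_ * fi_coord _).
have [thB _ thS] := bth.
apply/seteqP; split=> [_ [x [Ax kx] <-]|b [Bb lb]].
  by split; [apply: thB|rewrite /= e].
have [a Aa ea] := thS _ Bb; exists a => //; split=> //=.
by rewrite -e// ea.
Qed.

(** The relative coordinate of the kernel of a homomorphism onto P, which by
    [fi_coord_ker] only depends on P and on the index i of its domain. *)
Definition ker_coord i (gT : finGroupType) (P : {group gT}) : Q :=
  xget 1 [set q | exists A (k : F -> gT),
    [/\ has_index A i, onto_on A P k &
      (fi_coord A)^-1 * fi_coord (kernel A k) = q]].

(** An index from which on the rank is ample for groups of order q. *)
Definition rank_bound q := (q.+1 * q)%N.

Lemma rank_bound_leq p q : p <= q -> rank_bound p <= rank_bound q.
Proof. by move=> pq; apply: leq_mul. Qed.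

Lemma rank_bound_ample i (gT : finGroupType) (P : {group gT}) :
  rank_bound #|P| <= i -> ample_rank (i * r.-1).+1 P.
Proof.
move=> iP; apply/orP; left; apply: leq_trans iP _; apply: leqW.
by rewrite leq_pmulr// ltn_predRL.
Qed.

Lemma ker_coordE i (gT : finGroupType) (P : {group gT}) A (k : F -> gT) :
    ample_rank (i * r.-1).+1 P -> has_index A i -> onto_on A P k ->
  (fi_coord A)^-1 * fi_coord (kernel A k) = ker_coord i P.
Proof.
move=> mP iA ok; rewrite /ker_coord; case: xgetP => [_ -> [B [l [iB ol <-]]]|].
  exact: fi_coord_ker iA iB mP ok ol.
by move=> /(_ ((fi_coord A)^-1 * fi_coord (kernel A k)))[]; exists A, k.
Qed.

(** The homomorphism from the reference subgroup of index i onto the cyclic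
    group of order n has the reference subgroup of index i n as its kernel, and
    both have trivial coordinate. *)
Lemma ker_coord_cyclic i m : 0 < i -> ample_rank
    (i * r.-1).+1 [set: 'I_m.+1]%SET ->
  ker_coord i [set: 'I_m.+1]%G = 1.
Proof.
move=> i_gt0 mP.
rewrite -(ker_coordE mP (cyclic_sub_index freeX r_gt1 i_gt0)
  (cyclic_quo_onto freeX r_gt1 m i_gt0)).
have im : 0 < i * m.+1 by rewrite muln_gt0 i_gt0.
by rewrite /kernel cyclic_quo_ker// (fi_coord_cyclic i_gt0)
  (fi_coord_cyclic im) mulVg.
Qed.

Lemma index_onto i (gT : finGroupType) (P : {group gT}) : 0 < i ->
  rank_bound #|P| <= i ->
  exists k : F -> gT, onto_on (cyclic_sub i) P k.
Proof.
move=> i_gt0 iP; have ic := cyclic_sub_index freeX r_gt1 i_gt0.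
have [y fy] := index_free freeX r_gt0 ic; apply: (onto_on_exists fy).
apply: (@leq_trans i); first by apply: leq_trans iP; rewrite leq_pmull.
by apply: leqW; rewrite leq_pmulr// ltn_predRL.
Qed.

(** The kernel of a homomorphism onto P is reached in two steps, through the
    kernel of its composition with f. *)
Lemma ker_coord_morph i (gT hT : finGroupType) (P : {group gT})
    (f : {morphism P >-> hT}) :
  0 < i -> rank_bound #|P| <= i ->
  ker_coord i P = ker_coord i (f @* P)%G * ker_coord (i * #|f @* P|) ('ker f)%G.
Proof.
move=> i_gt0 iP; have [k ok] := index_onto i_gt0 iP; have [hk kP kS] := ok.
have ic := cyclic_sub_index freeX r_gt1 i_gt0.
have ofk : onto_on (cyclic_sub i) (f @* P) (f \o k).
  split=> [a b Aa Ab|a Aa|p /morphimP[q Pq _ ->]].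
  - by rewrite /= hk// morphM ?kP.
  - by rewrite mem_morphim// kP.
  - by have [a Aa <-] := kS _ Pq; exists a.
pose A := kernel (cyclic_sub i) (f \o k).
have iA : has_index A (i * #|f @* P|) := onto_on_index ic (P := (f @* P)%G) ofk.
have okA : onto_on A ('ker f) k.
  split=> [|a [Ca fa]|p kp].
  - by apply: hom_onS hk => a [].
  - by apply/kerP; rewrite ?kP.
  - have Pp := dom_ker kp; have fp := mker kp.
    by have [a Aa ea] := kS _ Pp; exists a => //; split=> //=; rewrite ea.
have m1 := rank_bound_ample iP.
have m2 : ample_rank (i * r.-1).+1 (f @* P)%G.
  by apply: rank_bound_ample; apply: leq_trans iP; apply: rank_bound_leq;
    apply: leq_morphim.
have m3 : ample_rank (i * #|f @* P| * r.-1).+1 ('ker f)%G.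
  apply: rank_bound_ample;
    apply: leq_trans (leq_pmulr _ (cardG_gt0 (f @* P)%G)).
  by apply: leq_trans iP; apply: rank_bound_leq; apply: subset_leq_card;
    apply: subsetIl.
rewrite -(ker_coordE m1 ic ok) -(ker_coordE m2 ic ofk) -(ker_coordE m3 iA okA).
rewrite -/A mulgA mulgK; congr (_ * fi_coord _).
apply/seteqP; split=> a; last by case=> -[].
by case=> Ca /= ka; split=> //; split=> //=; rewrite ka morph1.
Qed.

Lemma ker_coord1 i (gT : finGroupType) : 1 < i ->
  ker_coord i (1%G : {group gT}) = 1.
Proof.
move=> i_gt1; have i_gt0 := ltnW i_gt1;
  have ic := cyclic_sub_index freeX r_gt1 i_gt0.
have ok : onto_on (cyclic_sub i) (1%G : {group gT}) (fun=> 1).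
  split=> [a b _ _|a _|p /set1P->]; rewrite ?mulg1 ?group1//.
  by exists 1 => //; apply: subgroup1; apply: has_index_subgroup ic.
have mP : ample_rank (i * r.-1).+1 (1%G : {group gT}).
  by apply: rank_bound_ample; rewrite cards1.
rewrite -(ker_coordE mP ic ok).
have -> : kernel (cyclic_sub i) (fun=> 1 : gT) = cyclic_sub i
  by apply/seteqP; split=> a; [case|].
by rewrite mulVg.
Qed.

Lemma ker_coord_isog i (gT hT : finGroupType) (P : {group gT})
    (R : {group hT}) :
  1 < i -> rank_bound #|P| <= i -> P \isog R -> ker_coord i P = ker_coord i R.
Proof.
move=> i_gt1 iP /isogP[f /trivgP/eqP injf fP]; rewrite (ker_coord_morph f)//;
  last exact: ltnW.
have -> : ('ker f)%G = 1%G by apply/val_inj/eqP.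
rewrite ker_coord1 ?mulg1; first by congr ker_coord; apply: val_inj.
by apply: leq_trans i_gt1 _; apply: leq_pmulr; apply: (cardG_gt0 (f @* P)%G).
Qed.

Lemma ker_coord_exact i (gT hT kT : finGroupType) (P : {group gT})
    (R : {group hT})
    (K : {group kT}) (f : {morphism P >-> hT}) :
    1 < i -> rank_bound #|P| <= i -> f @* P = R -> 'ker f \isog K ->
  ker_coord i P = ker_coord i R * ker_coord (i * #|R|) K.
Proof.
move=> i_gt1 iP fP kK; rewrite (ker_coord_morph f)//; last exact: ltnW.
have -> : (f @* P)%G = R by apply: val_inj.
have iR : i <= i * #|R| by rewrite leq_pmulr.
congr (_ * _); rewrite fP; apply: ker_coord_isog => //;
  first exact: leq_trans iR.
apply: leq_trans iR; apply: leq_trans iP; apply: rank_bound_leq.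
by apply: subset_leq_card; apply: subsetIl.
Qed.

(** Both sides are the relative coordinate of the kernel of a homomorphism onto
    the direct product. *)
Lemma ker_coord_swap i (gT hT : finGroupType) (P : {group gT})
    (R : {group hT}) :
    1 < i -> rank_bound (#|P| * #|R|) <= i ->
  ker_coord i P * ker_coord (i * #|P|) R =
    ker_coord i R * ker_coord (i * #|R|) P.
Proof.
move=> i_gt1 iPR; rewrite -cardsX in iPR.
pose PR := setX_group P R.
pose p1 := [morphism of restrm (finset.subsetT PR) (@fst gT hT)].
pose p2 := [morphism of restrm (finset.subsetT PR) (@snd gT hT)].
transitivity (ker_coord i PR).
  apply/esym; apply: (@ker_coord_exact i _ _ _ PR P R p1) => //.
    by rewrite morphim_restrm finset.setIid morphim_fstX.
  rewrite (_ : 'ker p1 = finset.setX 1 R); first by rewrite isog_sym isog_set1X.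
  apply/setP => -[a b]; rewrite ker_restrm !finset.inE /= andbC.
  by case: eqP => // ->; rewrite group1.
apply: (@ker_coord_exact i _ _ _ PR R P p2) => //.
  by rewrite morphim_restrm finset.setIid morphim_sndX.
rewrite (_ : 'ker p2 = finset.setX P 1); first by rewrite isog_sym isog_setX1.
apply/setP => -[a b]; rewrite ker_restrm !finset.inE /=.
by case: eqP => [->|_]; rewrite ?andbF// group1 !andbT.
Qed.

End Calculus.

(** * The class of a finite group *)

Section GroupClass.
Variables (F : groupType) (r : nat) (X : 'I_r -> F).
Hypotheses (freeX : free_on setT X) (r_gt1 : 1 < r)
    (nA : normal_subgroup (AComm F)).
Implicit Types A B C : set F.

Let r_gt0 : 0 < r := ltnW r_gt1.
Local Notation Q := (quotient_group nA).
Local Notation cyclic_sub := (cyclic_sub freeX).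
Local Notation fi_coord := (fi_coord freeX nA).
Local Notation ker_coord := (ker_coord freeX nA).

(** The factor 2 leaves room for the direct product with the group of order two,
    which serves to double the index. *)
Definition threshold q := rank_bound (q * 2).

Lemma threshold_leq p q : p <= q -> threshold p <= threshold q.
Proof. by move=> pq; apply: rank_bound_leq; rewrite leq_mul2r pq orbT. Qed.

Lemma threshold_gt1 q : 0 < q -> 1 < threshold q.
Proof.
by case: q => // q _; rewrite /threshold /rank_bound mulSn !mulnS -addnA.
Qed.

Lemma rank_bound_threshold q : rank_bound q <= threshold q.
Proof. by apply: rank_bound_leq; rewrite leq_pmulr. Qed.

(** The swap of P with the cyclic group of order n, whose coordinates are
    trivial, multiplies the index by n, provided the index is large with respect
    to n. *)
Lemma ker_coord_muln i n (gT : finGroupType) (P : {group gT}) :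
  1 < i -> 0 < n -> rank_bound (#|P| * n) <= i -> ker_coord i P =
    ker_coord (i * n) P.
Proof.
move=> i_gt1; case: n => // n _ iPn; pose Z := [set: 'I_n.+1]%G.
have cZ : #|Z| = n.+1 by rewrite cardsT card_ord.
have iZ : rank_bound #|Z| <= i.
  by apply: leq_trans iPn; rewrite cZ; apply: rank_bound_leq; rewrite leq_pmull.
have Z1 j : i <= j -> ker_coord j Z = 1.
  move=> ij; apply: (ker_coord_cyclic freeX r_gt1 nA);
    first exact: leq_trans (ltnW i_gt1) ij.
  by apply: (@rank_bound_ample r r_gt1 j _ Z); apply: leq_trans iZ ij.
have := @ker_coord_swap _ _ _ freeX r_gt1 nA i _ _ P Z i_gt1.
rewrite cZ => /(_ iPn); rewrite !Z1 ?mulg1 ?mul1g//.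
by rewrite leq_pmulr.
Qed.

(** The index may be doubled any number of times, until it is large enough for
    the factor n, which is then inserted before undoing the doublings. *)
Lemma ker_coord_stable i n (gT : finGroupType) (P : {group gT}) :
  threshold #|P| <= i -> 0 < n -> ker_coord i P = ker_coord (i * n) P.
Proof.
move=> iP n_gt0; have i_gt1 := leq_trans (threshold_gt1 (cardG_gt0 P)) iP.
have pow j k : i <= j -> ker_coord j P = ker_coord (j * 2 ^ k) P.
  move=> ij; elim: k => [|k ->]; first by rewrite muln1.
  have jk : j <= j * 2 ^ k by rewrite leq_pmulr ?expn_gt0.
  rewrite expnSr mulnA; apply: ker_coord_muln => //.
    by apply: leq_trans jk; apply: leq_trans ij.
  by apply: leq_trans jk; apply: leq_trans ij.
pose k := rank_bound (#|P| * n).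
have ik : k <= i * 2 ^ k.
  apply: leq_trans (ltnW (ltn_expl k (ltnSn 1))) _.
  by rewrite leq_pmull// ltnW.
rewrite (pow i k)// (@ker_coord_muln _ n)//; last first.
  by apply: leq_trans i_gt1 _; rewrite leq_pmulr ?expn_gt0.
by rewrite mulnAC -pow// leq_pmulr.
Qed.

(** The relative coordinate of the kernel of a homomorphism onto P, for domains
    of large index; by [ker_coord_stable] it no longer depends on the index. *)
Definition group_class (gT : finGroupType) (P : {group gT}) : Q :=
  ker_coord (threshold #|P|) P.

Lemma ker_coord_group_class i (gT : finGroupType) (P : {group gT}) :
  threshold #|P| <= i -> ker_coord i P = group_class P.
Proof.
move=> iP; have t1 := threshold_gt1 (cardG_gt0 P).
rewrite (@ker_coord_stable _ (threshold #|P|))//; last exact: ltnW.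
rewrite mulnC -ker_coord_stable//; exact: leq_trans (ltnW t1) iP.
Qed.

Lemma fi_coord_kernel i (gT : finGroupType) (P : {group gT}) A (k : F -> gT) :
    has_index A i -> threshold #|P| <= i -> onto_on A P k ->
  fi_coord (kernel A k) = fi_coord A * group_class P.
Proof.
move=> iA iP ok; have iP' := leq_trans (rank_bound_threshold _) iP.
rewrite -(ker_coord_group_class iP)
  -(@ker_coordE _ _ _ freeX r_gt1 nA i _ P A k) ?mulVKg//.
exact: rank_bound_ample.
Qed.

Lemma group_class_comm (gT hT : finGroupType) (P : {group gT})
    (R : {group hT}) :
  group_class P * group_class R = group_class R * group_class P.
Proof.
pose i := threshold (#|P| * #|R|).
have P0 := cardG_gt0 P; have R0 := cardG_gt0 R.
have i1 : 1 < i by apply: threshold_gt1; rewrite muln_gt0 P0.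
have iP : threshold #|P| <= i by apply: threshold_leq; rewrite leq_pmulr.
have iR : threshold #|R| <= i by apply: threshold_leq; rewrite leq_pmull.
have := @ker_coord_swap _ _ _ freeX r_gt1 nA i _ _ P R i1
  (rank_bound_threshold _).
rewrite (ker_coord_group_class iP)
  (ker_coord_group_class iR) !ker_coord_group_class//.
  by apply: leq_trans iP _; rewrite leq_pmulr.
by apply: leq_trans iR _; rewrite leq_pmulr.
Qed.

Lemma group_class_exact (gT hT kT : finGroupType) (P : {group gT})
    (R : {group hT})
    (K : {group kT}) (f : {morphism P >-> hT}) :
  f @* P = R -> 'ker f \isog K -> group_class P = group_class R * group_class K.
Proof.
move=> fP kK; have t1 := threshold_gt1 (cardG_gt0 P).
have RP : #|R| <= #|P| by rewrite -fP leq_morphim.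
have KP : #|K| <= #|P|.
  by rewrite -(card_isog kK); apply: subset_leq_card; apply: subsetIl.
rewrite /group_class
  (ker_coord_exact freeX r_gt1 nA t1 (rank_bound_threshold _) fP kK).
rewrite ker_coord_group_class ?threshold_leq//; congr (_ * _);
  apply: ker_coord_group_class.
by apply: leq_trans (threshold_leq KP) _; rewrite leq_pmulr.
Qed.

Lemma group_class1 (gT : finGroupType) : group_class (1%G : {group gT}) = 1.
Proof. by apply: (ker_coord1 freeX r_gt1 nA); apply: threshold_gt1. Qed.

Lemma group_class_isog (gT hT : finGroupType) (P : {group gT})
    (R : {group hT}) :
  P \isog R -> group_class P = group_class R.
Proof.
move=> PR; rewrite /group_class -(card_isog PR).
by apply: (ker_coord_isog freeX r_gt1 nA) => //;
  [apply: threshold_gt1|apply: rank_bound_threshold].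
Qed.

Lemma group_class_cyclic (gT : finGroupType) (P : {group gT}) : cyclic P ->
  group_class P = 1.
Proof.
move=> cP; have [m em] : exists m, #|P| = m.+1 by exists #|P|.-1;
  rewrite prednK.
have isoP : P \isog [set: 'I_m.+1]%G.
  rewrite isog_cyclic_card// cardsT card_ord em eqxx andbT.
  by rewrite /= Zp_cycle cycle_cyclic.
rewrite (group_class_isog (R := [set: 'I_m.+1]%G) isoP).
have c : #|[set: 'I_m.+1]%G| = m.+1 by rewrite cardsT card_ord.
rewrite /group_class; apply: (ker_coord_cyclic freeX r_gt1 nA).
  by apply: ltnW; apply: threshold_gt1.
by apply: (@rank_bound_ample r r_gt1 _ _ [set: 'I_m.+1]%G);
  apply: rank_bound_threshold.
Qed.

(** With F and A replaced by subgroups of large index, this is [fi_coord_kernel]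
    for the homomorphisms onto P and onto S, which have the same kernel.  To
    reduce to this case, intersect with the reference subgroup of large prime
    index p.  This does not change the coordinates, by the uniqueness of
    homomorphisms onto a group of prime order from a free group of rank at least
    two. *)
Lemma fi_coord_group_class (gT : finGroupType) (P S : {group gT}) A
    (k : F -> gT) :
    fi_subgroup A -> kernel setT k `<=` A -> onto_on setT P k ->
      onto_on A S k ->
  fi_coord A = group_class P * (group_class S)^-1.
Proof.
move=> fA NA oP oS; have [i iA] := fi_has_index fA;
  have i_gt0 := has_index_gt0 iA.
have sA := fA.1; have [hk kP kPs] := oP.
have [[//|m] tp pr] := prime_above (threshold #|P|).
pose p := m.+1; rewrite -/p in tp pr; have p_gt0 : 0 < p by [].
pose z := cyclic_quo freeX 1 m.
have hz : hom_on setT z by rewrite -(cyclic_sub1 freeX); apply: cyclic_quo_hom.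
have kerz a : z a = 1 <-> cyclic_sub p a.
  have := cyclic_quo_ker freeX m (ltn0Sn 0); rewrite mul1n => <-.
  by split=> [za|[]//]; split=> //; rewrite cyclic_sub1.
pose Z := [set: 'I_m.+1]%G; have cZ : #|Z| = p by rewrite cardsT card_ord.
have sN : subgroup (kernel setT k).
  have := subgroup_preim 1%G (@subgroupT F) hk; congr subgroup.
  by apply/seteqP; split=> x [_ kx]; split=> //; apply/set1P.
(* The power of a basis element by the order of P lies in the kernel of k, and
   p does not divide its exponent sum. *)
have zN : onto_on (kernel setT k) Z z.
  have [Z0 zZ0] := image_group sN (hom_onS (@subsetT _ _) hz).
  suff -> : Z = Z0 by [].
  have i0 : 'I_r by exists 0; apply: ltnW.
  have kX n : k (X i0 ^+ n) = k (X i0) ^+ n.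
    elim: n => [|n IH]; first by rewrite !expg0 (hom_on1 (@subgroupT F) hk).
    by rewrite !expgS hk// IH.
  have NX : kernel setT k (X i0 ^+ #|P|).
    by split=> //=; rewrite kX expg_cardG// kP.
  have nz : z (X i0 ^+ #|P|) != 1.
    apply/eqP => /kerz; rewrite /cyclic_sub /= exponent_sumXn dvdzE /=.
    move=> /(dvdn_leq (cardG_gt0 P)); rewrite leqNgt (leq_ltn_trans _ tp)//.
    by apply: (@leq_trans (#|P| * 2)); [apply: leq_pmulr|apply: leq_pmull].
  have Zpr : prime #|Z| by rewrite cZ.
  apply/val_inj/eqP; rewrite /= eq_sym eqEcard finset.subsetT /=.
  have Z0_neq1 : #|Z0| != 1%N.
    rewrite -trivg_card1; apply/trivgPn; exists (z (X i0 ^+ #|P|)) => //.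
    by have [_ zZ _] := zZ0; apply: zZ.
  have Z0Z : #|Z0| %| #|Z| by apply: cardSg; apply: finset.subsetT.
  by rewrite (elimT (prime_nt_dvdP Zpr Z0_neq1) Z0Z) leqnn.
have zonto B : kernel setT k `<=` B -> onto_on B Z z.
  move=> NB; split=> [|x _|q Zq]; first exact: hom_onS hz.
    by rewrite finset.inE.
  by have [_ _ /(_ _ Zq)[x Nx <-]] := zN; exists x => //; apply: NB.
(* As the kernel of k already maps onto the group of order p, intersecting with
   the reference subgroup does not change the image under k. *)
have restr B (R : {group gT}) : subgroup B -> kernel setT k `<=` B ->
  onto_on B R k ->
    onto_on (B `&` cyclic_sub p) R k.
  move=> sB NB [hB kB sBk]; split=> [|x [Bx _]|q /sBk[b Bb <-]].
  - by apply: hom_onS hB => x [].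
  - exact: kB.
  - have [_ _ /(_ (z b))[|n Nn en]] := zN; first by rewrite finset.inE.
    have VN := subgroupV sN Nn.
    exists (b * n^-1); last by rewrite hk// VN.2 mulg1.
    split; first by apply: subgroupM => //; apply: NB.
    by apply/kerz; rewrite hz// (hom_onV (@subgroupT F) hz)// en mulgV.
have mZ j : 0 < j -> ample_rank (j * r.-1).+1 Z.
  move=> j_gt0; apply/orP; right; rewrite cZ pr andbT ltnS muln_gt0 j_gt0.
  by rewrite ltn_predRL.
have kerAz : kernel A z = A `&` cyclic_sub p.
  by apply/seteqP; split=> x [Ax zx]; split=> //; apply/kerz.
have eA : fi_coord (A `&` cyclic_sub p) = fi_coord A.
  have := ker_coordE freeX r_gt1 nA (mZ i i_gt0) iA (zonto A NA).
  rewrite kerAz (ker_coord_cyclic freeX r_gt1 nA i_gt0 (mZ i i_gt0)) => e.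
  by rewrite -[RHS]mulg1 -e mulVKg.
have icp := cyclic_sub_index freeX r_gt1 p_gt0.
have iAp : has_index (A `&` cyclic_sub p) (i * p).
  by rewrite -kerAz -cZ; apply: onto_on_index iA (zonto A NA).
have SP : #|S| <= #|P|.
  apply: subset_leq_card; apply/fintype.subsetP => q; case: oS => _ _ + Sq.
  by case/(_ _ Sq) => a _ <-; apply: kP.
have oP' := restr _ _ (@subgroupT F) (@subsetT _ _) oP; rewrite setTI in oP'.
have oS' := restr _ _ sA NA oS.
have := fi_coord_kernel icp (ltnW tp) oP'.
have tS : threshold #|S| <= i * p.
  apply: leq_trans (threshold_leq SP) _; apply: leq_trans (ltnW tp) _.
  by rewrite leq_pmull.
have := fi_coord_kernel iAp tS oS'.
have -> : kernel (A `&` cyclic_sub p) k = kernel (cyclic_sub p) k.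
  apply/seteqP; split=> x; first by case=> -[_ Cx] kx.
  by case=> Cx kx; do 2?split=> //; apply: NA.
move=> ->; rewrite eA fi_coord_cyclic// mul1g => <-.
by rewrite mulgK.
Qed.

End GroupClass.

(** * Isomorphism classes of finite groups *)

Section Keys.

(** Isomorphism classes of finite groups are represented by permutation groups,
    so that classes of groups of varying types form a single countable type. *)
Definition group_key := {n : nat & {group 'S_n}}.

Definition key_of n (gT : finGroupType) (P : {group gT}) : group_key :=
  Tagged (fun n => {group 'S_n})
    (odflt 1%G [pick H : {group 'S_n} | H \isog P]).

Definition key (gT : finGroupType) (P : {group gT}) := key_of #|P| P.

Lemma key_isog (gT hT : finGroupType) (P : {group gT}) (R : {group hT}) :
  P \isog R -> key P = key R.
Proof.
move=> PR; rewrite /key (card_isog PR) /key_of; congr (Tagged _ (odflt _ _)).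
by apply: eq_pick => H; apply: isog_transr.
Qed.

Lemma Cayley_ord (gT : finGroupType) (P : {group gT}) :
  exists H : {group 'S_#|P|}, H \isog P.
Proof.
pose act (x : gT) (i : 'I_#|P|) := enum_rank_in (group1 P) (enum_val i * x).
have actE x i : x \in P -> enum_val (act x i) = enum_val i * x.
  by move=> Px; rewrite /act enum_rankK_in// groupM// enum_valP.
have act_inj x : x \in P -> injective (act x).
  move=> Px i j /(congr1 enum_val); rewrite !actE// => /mulIg;
    exact: enum_val_inj.
pose f (x : gT) : 'S_#|P| := if insub x is Some u then
  perm (act_inj (@sgval _ P u) (subgP u)) else 1.
have fE x i : x \in P -> f x i = act x i.
  by move=> Px; rewrite /f insubT permE.
have fM : {in P &, {morph f : x y / x * y}}.
  move=> x y Px Py; apply/permP => i; apply: enum_val_inj.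
  by rewrite permM !fE ?groupM// !actE ?groupM// mulgA.
pose F := Morphism fM.
exists (F @* P)%G; rewrite isog_sym; apply/isogP; exists F => //.
apply/injmP => x y Px Py /permP/(_ (enum_rank_in (group1 P) 1)).
rewrite /= !fE// => /(congr1 enum_val); rewrite !actE//.
exact: mulgI.
Qed.

Lemma key_isogK (gT : finGroupType) (P : {group gT}) : tagged (key P) \isog P.
Proof.
rewrite /key /key_of /=; case: pickP => //= noH.
by have [H HP] := Cayley_ord P; have /= := noH H; rewrite HP.
Qed.

Definition nonabelian_simple (gT : finGroupType) (P : {set gT}) :=
  simple P && ~~ abelian P.

Lemma nonabelian_simple_isog (gT hT : finGroupType) (P : {group gT})
    (R : {group hT}) :
  P \isog R -> nonabelian_simple P = nonabelian_simple R.
Proof.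
by move=> PR; rewrite /nonabelian_simple (isog_simple PR) (isog_abelian PR).
Qed.

(** The second condition keeps one representative per isomorphism class. *)
Definition is_simple_key (k : group_key) :=
  nonabelian_simple (tagged k) && (key (tagged k) == k).

Definition simple_key := {k : group_key | is_simple_key k}.
HB.instance Definition _ := Choice.on simple_key.

Lemma is_simple_key_key (gT : finGroupType) (P : {group gT}) :
  is_simple_key (key P) = nonabelian_simple P.
Proof.
rewrite /is_simple_key (nonabelian_simple_isog (key_isogK P)).
by rewrite (key_isog (key_isogK P)) eqxx andbT.
Qed.

(** The alternating groups of degree at least five have distinct orders. *)
Lemma simple_key_infinite : infinite_set [set: simple_key].
Proof.
have cA n : (2 * #|'Alt_('I_(n + 5))|)%N = (n + 5)`!.
  by rewrite card_Alt card_ord ?addnS.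
have sA n : nonabelian_simple 'Alt_('I_(n + 5)).
  have simA : simple 'Alt_('I_(n + 5))
    by apply: simple_Alt5; rewrite card_ord !addnS.
  apply/andP; split=> //;
    apply/negP => /abelian_sol /simple_sol_prime /(_ simA) pr.
  (* If the group had prime order, both 3 and 5 would be equal to its order. *)
  have dvd q : prime q -> 2 < q <= 5 -> q = #|'Alt_('I_(n + 5))|.
    move=> pq /andP[q2 q5]; have : q %| (n + 5)`!.
      by apply: dvdn_fact; rewrite prime_gt0//= (leq_trans q5) ?leq_addl.
    rewrite -cA Euclid_dvdM// => /orP[/dvdn_leq|];
      last by rewrite dvdn_prime2// => /eqP.
    by move=> /(_ isT); rewrite leqNgt q2.
  by have := dvd 3 isT isT; rewrite -(dvd 5 isT isT).
have kA n : is_simple_key (key 'Alt_('I_(n + 5))%G)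
  by rewrite is_simple_key_key.
pose e n : simple_key := exist (fun k => is_simple_key k) _ (kA n).
move=> fin; have := @finite_preimage _ _ setT e; rewrite preimage_setT.
move=> /(_ _ fin) finN; apply: infinite_nat; apply: finN => m n _ _.
move=> /(congr1 (fun k => tag (val k))) /= ecard.
have := cA m; rewrite ecard cA => efact.
have lt_fact a b : a < b -> (a + 5)`! < (b + 5)`!.
  move=> ab; apply: ltn_fact; last by rewrite ltn_add2r.
  exact: leq_trans (leq_addl a 5).
by case: (ltngtP m n) => // /lt_fact; rewrite efact ltnn.
Qed.

End Keys.

(** * Composition factors *)

Section CompositionFactors.

Definition series_keys (gT : finGroupType) (P : {group gT})
    (s : seq {group gT}) :=
  [seq key (section_group u) | u <- pairmap (@mkSec _) P s].

Lemma series_keys_perm (gT : finGroupType) (P : {group gT}) s t :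
  comps P s -> comps P t -> perm_eq (series_keys P s) (series_keys P t).
Proof.
move=> cs ct.
have e u : series_keys P u = [seq key (section_group v) | v <- mkfactors P u].
  rewrite /mkfactors -map_comp; apply: eq_map => v /=.
  by apply/esym/key_isog; apply: section_reprP.
by rewrite !e; apply: perm_map; apply: JordanHolderUniqueness.
Qed.

Definition composition_keys (gT : finGroupType) (P : {group gT}) :=
  series_keys P (xchoose (exists_comps P)).

Lemma composition_keys_perm (gT : finGroupType) (P : {group gT}) s :
  comps P s -> perm_eq (composition_keys P) (series_keys P s).
Proof.
by move=> cs; apply: series_keys_perm => //; apply: (xchooseP (exists_comps P)).
Qed.

Section Preimage.
Variables (gT hT : finGroupType) (P : {group gT}) (f : {morphism P >-> hT}).

Lemma quotient_morphpre (K H : {group hT}) : K \subset f @* P -> H <| K ->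
  (f @*^-1 K / f @*^-1 H) \isog (K / H).
Proof.
move=> KfP nHK; have [HK nH] := andP nHK.
pose g := [morphism of coset H \o f].
have sD : f @*^-1 K \subset f @*^-1 'N(H) by apply: morphpreS.
have := @first_isog_loc _ _ _ (f @*^-1 K)%G g sD.
rewrite morphim_comp morphpreK// ker_comp ker_coset.
by rewrite (finset.setIidPr (morphpreS _ HK)).
Qed.

Lemma maxnormal_simple (T : finGroupType) (H K : {group T}) :
  maxnormal H K K = (H <| K) && simple (K / H).
Proof.
apply/idP/andP => [m|[nHK]]; last by rewrite quotient_simple.
by have nHK := maxnormal_normal m; rewrite quotient_simple.
Qed.

(** A composition series of the image pulls back to the upper part of a
    composition series of the source, with the same factors. *)
Lemma morphpre_comps (K : {group hT}) s u :
    K \subset f @* P -> comps K s -> comps ('ker f)%G u ->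
  let t := [seq (f @*^-1 H)%G | H : {group hT} <- s] in
  comps (f @*^-1 K)%G (t ++ u) /\
  series_keys (f @*^-1 K)%G (t ++ u) =
    series_keys K s ++ series_keys ('ker f)%G u.
Proof.
elim: s K => [|H s IH] K KfP cs cu /=.
  have K1 : K = 1%G by case/andP: cs => /eqP.
  have -> : (f @*^-1 K)%G = ('ker f)%G by apply: val_inj; rewrite /= K1.
  by split.
have cs' := comps_cons cs; have [] := andP cs => _ /= /andP[mHK _].
have := mHK; rewrite maxnormal_simple => /andP[nHK sKH].
have HfP : H \subset f @* P
  by apply: fintype.subset_trans KfP; apply: normal_sub.
have [c e] := IH H HfP cs' cu.
have iso := quotient_morphpre KfP nHK.
split; last first.
  rewrite /series_keys /= -/(series_keys _ _); congr cons; last exact: e.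
  exact: key_isog.
case/andP: c => lc pc; rewrite /comps /= lc pc andbT /=.
by rewrite maxnormal_simple morphpre_normal// nHK (isog_simple iso).
Qed.

Lemma composition_keys_morph :
  perm_eq (composition_keys P)
    (composition_keys (f @* P)%G ++ composition_keys ('ker f)%G).
Proof.
have [s cs] := exists_comps (f @* P)%G; have [u cu] := exists_comps ('ker f)%G.
have [] := morphpre_comps (subxx _) cs cu.
have -> : (f @*^-1 (f @* P))%G = P.
  by apply: val_inj; rewrite /= morphimGK// subsetIl.
move=> c e; apply: (perm_trans (composition_keys_perm c)); rewrite e.
by rewrite perm_sym; apply: perm_cat; apply: composition_keys_perm.
Qed.

End Preimage.
End CompositionFactors.

Section Content.

Definition simple_gen (k : simple_key) : {freeg simple_key / int} :=
  Freeg [:: (1%R, k)].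

Definition simple_keys (gT : finGroupType) (P : {group gT}) : seq simple_key :=
  pmap insub (composition_keys P).

(** The nonabelian composition factors of P, counted with multiplicity. *)
Definition content (gT : finGroupType) (P : {group gT}) :
  {freeg simple_key / int} :=
  (\sum_(k <- simple_keys P) simple_gen k)%R.

Lemma content_morph (gT hT : finGroupType) (P : {group gT})
    (f : {morphism P >-> hT}) :
  content P = (content (f @* P)%G + content ('ker f)%G)%R.
Proof.
rewrite /content -big_cat -pmap_cat; apply: perm_big; apply: perm_pmap.
exact: composition_keys_morph.
Qed.

Lemma content1 (gT : finGroupType) : content (1%G : {group gT}) = 0%R.
Proof.
have c1 : comps (1%G : {group gT}) [::] by rewrite /comps eqxx.
have := composition_keys_perm c1; rewrite /content /simple_keys.
by rewrite /series_keys /= => /perm_nilP->; rewrite big_nil.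
Qed.

Lemma content_exact (gT hT kT : finGroupType) (P : {group gT}) (R : {group hT})
    (K : {group kT}) (f : {morphism P >-> hT}) :
  f @* P = R -> 'ker f \isog K -> content P = (content R + content K)%R.
Proof.
have isog (aT bT : finGroupType) (A : {group aT}) (B : {group bT}) :
    A \isog B -> content A = content B.
  case/isogP => g injg gA; rewrite (content_morph g).
  have -> : ('ker g)%G = 1%G by apply: val_inj; apply/trivgP.
  by rewrite content1 GRing.addr0; congr content; apply: val_inj.
move=> fP kK; rewrite (content_morph f) -(isog _ _ _ _ kK).
by congr (content _ + _)%R; apply: val_inj.
Qed.

Lemma content_simple (gT : finGroupType) (P : {group gT}) : simple P ->
  content P = (\sum_(k <- pmap insub [:: key P]) simple_gen k)%R.
Proof.
move=> sP; have cP : comps P [:: 1%G].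
  by rewrite /comps eqxx /= -simple_maxnormal andbT.
rewrite /content; apply: perm_big; apply: perm_pmap.
have -> : [:: key P] = series_keys P [:: 1%G];
  last exact: composition_keys_perm.
rewrite /series_keys /=; congr [:: _]; apply: key_isog.
exact: quotient1_isog.
Qed.

Lemma content_key (k : simple_key) : content (tagged (val k)) = simple_gen k.
Proof.
have /andP[/andP[sk _] /eqP ek] := valP k.
by rewrite content_simple// ek /= valK big_seq1.
Qed.

(** Induction along a composition series. *)
Lemma simple_ind (Pr : forall gT : finGroupType, {group gT} -> Prop) :
    (forall gT, Pr gT 1%G) ->
      (forall gT (P : {group gT}), simple P -> Pr gT P) ->
    (forall gT (P N : {group gT}), N <| P -> Pr _ (P / N)%G -> Pr _ N ->
      Pr _ P) ->
  forall gT (P : {group gT}), Pr gT P.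
Proof.
move=> P1 Ps Pe gT P; have [n] := ubnP #|P|;
  elim: n gT P => // n IH gT P /ltnSE cP.
have [P1'|ntP] := eqVneq (P : {set gT}) 1;
  first by have -> : P = 1%G by apply: val_inj.
have [N mN] := ex_maxnormal_ntrivg ntP.
have nNP := maxnormal_normal mN.
apply: (Pe _ P N nNP); first by apply: Ps; rewrite quotient_simple.
apply: IH; apply: leq_trans cP; apply: proper_card; exact: maxnormal_proper mN.
Qed.

End Content.

Lemma quotient_morphism (gT : finGroupType) (P N : {group gT}) : N <| P ->
  exists f : {morphism P >-> coset_of N}, f @* P = P / N /\ 'ker f = N.
Proof.
move=> nNP; exists [morphism of restrm (normal_norm nNP) (coset N)].
by rewrite morphim_restrm finset.setIid ker_restrm ker_coset; split=> //;
  apply/finset.setIidPr/normal_sub.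
Qed.

Lemma simple_abelian_content (gT : finGroupType) (P : {group gT}) :
  simple P -> abelian P -> content P = 0%R.
Proof.
move=> sP aP; rewrite content_simple//= insubF ?big_nil//.
by apply/negbTE; rewrite is_simple_key_key /nonabelian_simple aP andbF.
Qed.

Lemma abelian_content (gT : finGroupType) (P : {group gT}) : abelian P ->
  content P = 0%R.
Proof.
move: gT P; apply: simple_ind => [gT _|gT P sP aP|gT P N nNP IHq IHN aP].
- exact: content1.
- exact: simple_abelian_content.
- have [f [fP kf]] := quotient_morphism nNP.
  rewrite (@content_exact _ _ _ P (P / N)%G N f)// ?kf ?isog_refl//.
  by rewrite IHq ?IHN ?GRing.addr0 ?quotient_abelian//
    (abelianS (normal_sub nNP)).
Qed.

(** * The class of a finite group is determined by its content *)

Section GroupClassContent.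
Variables (F : groupType) (r : nat) (X : 'I_r -> F).
Hypotheses (freeX : free_on setT X) (r_gt1 : 1 < r)
    (nA : normal_subgroup (AComm F)).
Local Notation group_class := (group_class freeX nA).

Let simple_class (k : simple_key) := group_class (tagged (val k)).

Lemma group_class_factors (gT : finGroupType) (P : {group gT}) :
  exists s : seq simple_key,
    content P = (\sum_(k <- s) simple_gen k)%R /\
    group_class P = \prod_(k <- s) simple_class k.
Proof.
move: gT P;
  apply: simple_ind => [gT|gT P sP|gT P N nNP [s [cs es]] [t [ct et]]].
- exists [::]; rewrite !big_nil content1; split=> //; exact: group_class1.
- have [aP|naP] := boolP (abelian P).
    exists [::]; rewrite !big_nil simple_abelian_content//; split=> //.
    apply: group_class_cyclic => //; apply: prime_cyclic;
      apply: simple_sol_prime => //.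
    exact: abelian_sol.
  have kP : is_simple_key (key P)
    by rewrite is_simple_key_key /nonabelian_simple sP.
  exists [:: exist (fun k => is_simple_key k) _ kP]; rewrite !big_seq1.
  rewrite content_simple//= insubT big_seq1; split=> //.
  by apply/esym/group_class_isog => //; apply: key_isogK.
- have [f [fP kf]] := quotient_morphism nNP;
  have kN : 'ker f \isog N by rewrite kf isog_refl.
  exists (s ++ t); rewrite !big_cat -cs -ct -es -et; split.
    exact: (@content_exact _ _ _ P (P / N)%G N f).
  exact: (@group_class_exact _ _ _ freeX r_gt1 nA _ _ _ P (P / N)%G N f).
Qed.

Lemma prod_simple_class_perm (s t : seq simple_key) :
  perm_eq s t -> \prod_(k <- s) simple_class k = \prod_(k <- t) simple_class k.
Proof.
elim: s t => [|k s IH] t pst;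
  first by have /perm_nilP-> : perm_eq t [::] by rewrite perm_sym.
have kt : k \in t by rewrite -(perm_mem pst) mem_head.
have pull (u : seq simple_key) : k \in u ->
    \prod_(j <- u) simple_class j =
      simple_class k * \prod_(j <- rem k u) simple_class j.
  elim: u => // j u IHu; rewrite inE /= eq_sym; have [->|nkj] := eqVneq j k.
    by rewrite big_cons.
  by move=> /= ku;
    rewrite !big_cons IHu// !mulgA /simple_class
      (group_class_comm freeX r_gt1 nA).
rewrite big_cons (pull t)// (IH (rem k t))//.
by rewrite -(perm_cons k); apply: perm_trans pst _; apply: perm_to_rem.
Qed.

Lemma group_class_content (gT hT : finGroupType) (P : {group gT})
    (R : {group hT}) :
  content P = content R -> group_class P = group_class R.
Proof.
have [s [cs ->]] := group_class_factors P;
  have [t [ct ->]] := group_class_factors R.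
rewrite cs ct => est; apply: prod_simple_class_perm.
have cnt (u : seq simple_key) k :
    coeff k (\sum_(j <- u) simple_gen j)%R = Posz (count_mem k u).
  elim: u => [|j u IHu]; first by rewrite big_nil coeff0.
  by rewrite big_cons coeffD IHu /simple_gen coeffU GRing.mul1r /= PoszD;
    case: (j == k).
apply/allP => k _ /=; apply/eqP.
by have := congr1 (coeff k) est; rewrite !cnt => -[].
Qed.

End GroupClassContent.

(** * The defect of a subgroup of finite index *)

Section Defect.
Variable F : groupType.
Implicit Types A B C : set F.
Local Open Scope ring_scope.

(** The images T and P differ by the kernel of f on T, and likewise T' and P';
    the two kernels coincide because an element of A that f o k kills lies in
    C. *)
Lemma content_ker_eq A C (gT hT : finGroupType)
    (f : {morphism [set: hT] >-> gT})
    (k : F -> hT) (T T' : {group hT}) (P P' : {group gT}) :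
    C `<=` A -> kernel A (f \o k) `<=` C -> onto_on A T k -> onto_on C T' k ->
    onto_on A P (f \o k) -> onto_on C P' (f \o k) ->
  content T - content T' = content P - content P'.
Proof.
move=> sCA kC [hk kT kTs] [_ kT' kTs'] [_ kP kPs] [_ kP' kPs'].
pose fT := [morphism of restrm (finset.subsetT T) f].
pose fT' := [morphism of restrm (finset.subsetT T') f].
have eT : fT @* T = P.
  rewrite morphim_restrm finset.setIid; apply/setP => p; apply/morphimP/idP.
    by case=> x _ /kTs[a Aa <-] ->; apply: kP.
  by case/kPs => a Aa <-; exists (k a); rewrite ?finset.inE//; apply: kT.
have eT' : fT' @* T' = P'.
  rewrite morphim_restrm finset.setIid; apply/setP => p; apply/morphimP/idP.
    by case=> x _ /kTs'[a Aa <-] ->; apply: kP'.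
  by case/kPs' => a Aa <-; exists (k a); rewrite ?finset.inE//; apply: kT'.
have eK : 'ker fT = 'ker fT'.
  rewrite !ker_restrm; apply/setP => x; rewrite !finset.inE /=.
  apply/andP/andP => -[Tx fx]; split=> //.
    have [a Aa ea] := kTs _ Tx; rewrite -ea; apply: kT'; apply: kC; split=> //=.
    by rewrite ea; apply/eqP.
  by have [a Ca <-] := kTs' _ Tx; apply: kT; apply: sCA.
rewrite (@content_exact _ _ _ T P ('ker fT)%G fT eT (isog_refl _)).
have kT'T : 'ker fT' \isog 'ker fT by rewrite eK isog_refl.
rewrite (@content_exact _ _ _ T' P' ('ker fT)%G fT' eT' kT'T).
by rewrite GRing.opprD GRing.addrACA GRing.subrr GRing.addr0.
Qed.

(** The difference of the contents of the images of A and of a subgroup C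
    under a homomorphism whose kernel lies in C does not depend on this
    homomorphism: compare any two of them with their product. *)
Lemma content_pair A C (gT hT : finGroupType) (k : F -> gT) (l : F -> hT)
    (P P' : {group gT}) (S S' : {group hT}) :
    subgroup A -> subgroup C -> C `<=` A -> kernel A k `<=` C ->
      kernel A l `<=` C ->
    onto_on A P k -> onto_on C P' k -> onto_on A S l -> onto_on C S' l ->
  content P - content P' = content S - content S'.
Proof.
move=> sA sC sCA kC lC oP oP' oS oS'; have [hk _ _] := oP; have [hl _ _] := oS.
pose m x : gT * hT := (k x, l x).
have hm : hom_on A m by move=> x y Ax Ay; rewrite /m hk// hl.
have [T oT] := image_group sA hm;
  have [T' oT'] := image_group sC (hom_onS sCA hm).
transitivity (content T - content T').
  by apply/esym; apply: (@content_ker_eq A C _ _ (fst_morphism gT hT) m).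
by apply: (@content_ker_eq A C _ _ (snd_morphism gT hT) m).
Qed.

(** The content of F / N minus the content of A / N, for any normal subgroup N
    of finite index contained in A. *)
Definition defect A : {freeg simple_key / int} :=
  xget 0 [set d | exists (gT : finGroupType) (k : F -> gT) (P S : {group gT}),
    [/\ onto_on setT P k, onto_on A S k, kernel setT k `<=` A &
      content P - content S = d]].

Lemma defectE A (gT : finGroupType) (k : F -> gT) (P S : {group gT}) :
  subgroup A -> onto_on setT P k -> onto_on A S k -> kernel setT k `<=` A ->
  defect A = content P - content S.
Proof.
move=> sA oP oS kA; rewrite /defect;
  case: xgetP => [_ -> [hT [l [Q [R [oQ oR lA <-]]]]]|].
  exact: (content_pair (@subgroupT F) sA (@subsetT _ _) lA kA).
by move=> /(_ (content P - content S))[]; exists gT, k, P, S.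
Qed.

Lemma finite_quotient A : fi_subgroup A -> exists (gT : finGroupType)
    (k : F -> gT)
  (P : {group gT}), onto_on setT P k /\ kernel setT k `<=` A.
Proof.
move=> fA; have [n [T [w [wA _]]]] := fi_has_index fA.
have [P oP] := image_group (@subgroupT F) (coset_perm_hom wA).
exists {perm T}, (coset_perm wA), P; split=> // x [_ /= kx].
apply/(coset_act_base wA).
by have := congr1 (fun s : {perm T} => s (w 1%g)) kx; rewrite permE perm1.
Qed.

Lemma defect_sub A C (gT : finGroupType) (k : F -> gT) (P P' : {group gT}) :
    fi_subgroup A -> fi_subgroup C -> C `<=` A -> kernel A k `<=` C ->
    onto_on A P k -> onto_on C P' k ->
  defect C - defect A = content P - content P'.
Proof.
move=> fA fC sCA kC oP oP'; have [hT [l [S [oS lC]]]] := finite_quotient fC.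
have [hl _ _] := oS.
have [R oR] := image_group fA.1 (hom_onS (@subsetT _ A) hl).
have [R' oR'] := image_group fC.1 (hom_onS (@subsetT _ C) hl).
have lA : kernel setT l `<=` A := subset_trans lC sCA.
rewrite (defectE fC.1 oS oR' lC) (defectE fA.1 oS oR lA).
have lAC : kernel A l `<=` C by move=> x [_ lx]; apply: lC.
rewrite (content_pair fA.1 fC.1 sCA kC lAC oP oP' oR oR').
by rewrite GRing.opprB GRing.addrC GRing.addrA GRing.subrK.
Qed.

Lemma defect_viso (f : viso F) C : fi_subgroup C -> C `<=` vdom f ->
  defect C - defect (vdom f) = defect (vfun f @` C) - defect (vcod f).
Proof.
move=> fC sC; have fD := viso_image_fi fC sC.
have sD : vfun f @` C `<=` vcod f
  by move=> _ [x Cx <-]; apply: vfun_dom; apply: sC.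
have [hT [l [S [oS lD]]]] := finite_quotient fD; have [hl _ _] := oS.
have [R oR] := image_group (vcodP f).1 (hom_onS (@subsetT _ _) hl).
have [R' oR'] := image_group fD.1 (hom_onS (@subsetT _ _) hl).
have lcod : kernel (vcod f) l `<=` vfun f @` C by move=> x [_ lx]; apply: lD.
rewrite (defect_sub (vcodP f) fD sD lcod oR oR').
have [_ RP Ron] := oR; have [_ RP' Ron'] := oR'.
apply: (@defect_sub (vdom f) C _ (l \o vfun f)) => //; first exact: vdomP.
- move=> x [fx lx]; have [|y Cy e] := lD (vfun f x); first by split.
  by have <- : y = x by apply: vfun_inj e => //; apply: sC.
- split=> [x y fx fy|x fx|p /Ron[y fy <-]].
  + by rewrite /= viso_hom// hl.
  + by apply: RP; apply: vfun_dom.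
  + by have [fx e] := vinvfunP fy; exists (vinvfun f y) => //=; rewrite e.
- split=> [x y /sC fx /sC fy|x Cx|p /Ron'[_ [x Cx <-] <-]].
  + by rewrite /= viso_hom// hl.
  + by apply: RP'; exists x.
  + by exists x.
Qed.

End Defect.

(** * The isomorphism with a free abelian group *)

Section Invariant.
Variable F : groupType.
Implicit Types f g : viso F.
Local Open Scope ring_scope.

Definition shift f := defect (vcod f) - defect (vdom f).

(** Isomorphic pairs of nested subgroups have the same difference of defects, so
    the shift is unchanged by restriction and only depends on the class of f. *)
Lemma shift_restrict f (C : set F) : fi_subgroup C -> C `<=` vdom f ->
  shift f = defect (vfun f @` C) - defect C.
Proof.
move=> fC sC; have e := defect_viso fC sC; rewrite /shift.
have -> : defect (vfun f @` C) = defect C - defect (vdom f) + defect (vcod f).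
  by rewrite e GRing.subrK.
by rewrite GRing.addrAC
  [_ - _ - _ ]GRing.addrAC GRing.subrr GRing.sub0r GRing.addrC.
Qed.

Lemma shift_agree f g : vagree f g -> shift f = shift g.
Proof.
move=> [C [fC Cf Cg e]]; rewrite (shift_restrict fC Cf) (shift_restrict fC Cg).
congr (defect _ - _); apply/seteqP; split=> _ [x Cx <-]; exists x => //.
  by rewrite e.
by rewrite -e.
Qed.

Lemma shift_comp g f : shift (vcomp g f) = shift g + shift f.
Proof.
have fC := vcomp_domP g f; have sC : vcomp_dom g f `<=` vdom f by move=> x [].
have fD : fi_subgroup (vcod f `&` vdom g) by apply: fi_subgroupI;
  [apply: vcodP|apply: vdomP].
rewrite (shift_restrict fC sC) (shift_restrict fD (@subIsetr _ _ _)).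
have -> : vfun f @` vcomp_dom g f = vcod f `&` vdom g.
  apply/seteqP; split=> [_ [x [_ ?] <-]//|y [fy gy]].
  have [fx e] := vinvfunP fy; exists (vinvfun f y) => //.
  by split=> //=; rewrite e.
by rewrite GRing.addrA GRing.subrK.
Qed.

Definition comm_shift (c : Comm F) := shift (generic_quotient.repr c).

Lemma comm_shiftE f : comm_shift (comm_class f) = shift f.
Proof. by apply: shift_agree; apply: vagree_repr. Qed.

Lemma comm_shiftM : {morph comm_shift : c d / (c * d)%g >-> c + d}.
Proof.
move=> c d; have [g <-] := comm_class_surj c; have [f <-] := comm_class_surj d.
by rewrite -[(_ * _)%g]/(comm_mul _ _) comm_mulE !comm_shiftE shift_comp.
Qed.

Lemma comm_shift1 : comm_shift 1%g = 0.
Proof.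
by apply: (@GRing.addrI _ (comm_shift 1%g));
  rewrite -comm_shiftM mulg1 GRing.addr0.
Qed.

Lemma comm_shiftV c : comm_shift c^-1%g = - comm_shift c.
Proof.
by apply: (@GRing.addrI _ (comm_shift c));
  rewrite -comm_shiftM mulgV comm_shift1 GRing.subrr.
Qed.

Lemma comm_shift_AComm c : AComm F c -> comm_shift c = 0.
Proof.
move=> Ac; suff : [set c | comm_shift c = 0] c by [].
move: c Ac; apply: generated_sub => [|_ [A _ [f [df cf] <-]]].
  split=> [|c d]; first exact: comm_shift1.
  by move=> /= ec ed; rewrite comm_shiftM comm_shiftV ec ed GRing.subrr.
by rewrite /= comm_shiftE /shift df cf GRing.subrr.
Qed.

End Invariant.

Section Iso.
Variables (F : groupType) (r : nat) (X : 'I_r -> F).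
Hypotheses (freeX : free_on setT X) (r_gt1 : (1 < r)%N)
    (nA : normal_subgroup (AComm F)).
Local Notation Q := (quotient_group nA).
Local Notation quo_class := (quo_class nA).
Local Notation fi_coord := (fi_coord freeX nA).

Definition quo_shift (q : Q) := comm_shift (generic_quotient.repr q).

Lemma quo_shiftE c : quo_shift (quo nA c) = comm_shift c.
Proof.
rewrite /quo_shift; set d := generic_quotient.repr _.
have /quoP/comm_shift_AComm : quo nA d = quo nA c by rewrite quo_repr.
rewrite comm_shiftM comm_shiftV GRing.addrC => /eqP.
by rewrite GRing.subr_eq0 => /eqP.
Qed.

Lemma quo_shift_cl f : quo_shift (quo_class f) = shift f.
Proof. by rewrite quo_shiftE comm_shiftE. Qed.

Lemma quo_shiftM : {morph quo_shift : p q / p * q >-> (p + q)%R}.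
Proof.
move=> p q; have [g <-] := quo_class_surj p; have [f <-] := quo_class_surj q.
rewrite /quo_class -[quo _ _ * _]/(quo_mul _ _) quo_mulE !quo_shiftE.
exact: comm_shiftM.
Qed.

Lemma quo_shift1 : quo_shift 1 = 0%R.
Proof.
by apply: (@GRing.addrI _ (quo_shift 1)); rewrite -quo_shiftM mulg1 GRing.addr0.
Qed.

Lemma quo_shiftV q : quo_shift q^-1 = (- quo_shift q)%R.
Proof.
by apply: (@GRing.addrI _ (quo_shift q));
  rewrite -quo_shiftM mulgV quo_shift1 GRing.subrr.
Qed.

(** By [fi_coord_group_class] for a common finite quotient, the coordinates are
    determined by the contents of the images of the subgroups. *)
Lemma fi_coord_defect (A B : set F) : fi_subgroup A -> fi_subgroup B ->
  defect A = defect B -> fi_coord A = fi_coord B.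
Proof.
move=> fA fB eAB;
  have [gT [k [P [oP kAB]]]] := finite_quotient (fi_subgroupI fA fB).
have kA : kernel setT k `<=` A by move=> x /kAB[].
have kB : kernel setT k `<=` B by move=> x /kAB[].
have [hk _ _] := oP.
have [S oS] := image_group fA.1 (hom_onS (@subsetT _ _) hk).
have [R oR] := image_group fB.1 (hom_onS (@subsetT _ _) hk).
rewrite (fi_coord_group_class freeX r_gt1 nA fA kA oP oS)
  (fi_coord_group_class freeX r_gt1 nA fB kB oP oR).
congr (_ * _^-1); apply: (group_class_content freeX r_gt1 nA).
move: eAB; rewrite (defectE fA.1 oP oS kA) (defectE fB.1 oP oR kB).
by move=> /GRing.addrI /GRing.oppr_inj.
Qed.

Lemma quo_shift_inj : injective quo_shift.
Proof.
have ker q : quo_shift q = 0%R -> q = 1.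
  have [f <-] := quo_class_surj q; rewrite quo_shift_cl => /eqP;
    rewrite GRing.subr_eq0 => /eqP e.
  rewrite (quo_class_coord freeX r_gt1) (fi_coord_defect (vcodP f) (vdomP f) e).
  exact: mulgV.
move=> p q e; apply: (mulgI p^-1); rewrite mulVg; apply/esym/ker.
by rewrite quo_shiftM quo_shiftV e GRing.addNr.
Qed.

(** A nonabelian simple group S of order n is realised by an isomorphism from
    the kernel of a homomorphism onto a cyclic group of order n to the kernel
    of a homomorphism onto S, both defined on the same subgroup. *)
Lemma quo_shift_gen k : exists q, quo_shift q = simple_gen k.
Proof.
pose S := tagged (val k); have S_gt0 : 0 < #|S| := cardG_gt0 S.
pose i := rank_bound #|S|.
have i_gt0 : 0 < i by rewrite muln_gt0.
have ic := cyclic_sub_index freeX r_gt1 i_gt0; have fc := has_index_fi ic.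
have [u ou] := index_onto freeX r_gt1 i_gt0 (leqnn i).
pose K := kernel (cyclic_sub freeX i) u.
have iK : has_index K (i * #|S|) := onto_on_index ic ou.
have [m em] : exists m, #|S| = m.+1 by exists #|S|.-1; rewrite prednK.
have oz := cyclic_quo_onto freeX r_gt1 m i_gt0.
pose L := kernel (cyclic_sub freeX i) (cyclic_quo freeX i m).
have iL : has_index L (i * #|S|).
  have := onto_on_index (P := [set: 'I_m.+1]%G) ic oz.
  by rewrite cardsT card_ord -em.
have [f [df cf]] := index_viso freeX r_gt1 iL iK.
exists (quo_class f); rewrite quo_shift_cl /shift df cf.
have trivial_image (gT : finGroupType) (P : {group gT}) (v : F -> gT) B :
    subgroup B -> onto_on B P v -> onto_on (kernel B v) (1%G : {group gT}) v.
  move=> sB [hv _ _]; split=> [|x [_ vx]|p /set1P->]; last 2 first.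
  - by apply/set1P.
  - by exists 1; rewrite ?(hom_on1 sB hv)//; split;
    [apply: subgroup1|apply: hom_on1 hv].
  - by apply: hom_onS hv => x [].
have KC : K `<=` cyclic_sub freeX i by move=> x [].
have LC : L `<=` cyclic_sub freeX i by move=> x [].
have eK := defect_sub fc (has_index_fi iK) KC (@subset_refl _ K) ou
  (trivial_image _ _ _ _ fc.1 ou).
have eL := defect_sub (P := [set: 'I_m.+1]%G) fc (has_index_fi iL) LC
  (@subset_refl _ L) oz
  (trivial_image _ [set: 'I_m.+1]%G _ _ fc.1 oz).
move: eK eL; rewrite !content1 content_key abelian_content; last first.
  by apply: cyclic_abelian; rewrite /= Zp_cycle cycle_cyclic.
rewrite !GRing.subr0 => eK /eqP; rewrite GRing.subr_eq0 => /eqP ->.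
exact: eK.
Qed.

Lemma quo_shift_surj d : exists q, quo_shift q = d.
Proof.
elim/freeg_ind_dom0: d => [|z k d _ _ [q <-]];
  first by exists 1; apply: quo_shift1.
have [p ep] := quo_shift_gen k.
have pw n : quo_shift (p ^+ n) = Freeg [:: (Posz n, k)].
    elim: n => [|n IH]; first by rewrite expg0 quo_shift1 freegU0.
    by rewrite expgS quo_shiftM ep IH /simple_gen freegUD -PoszD.
case: z => n.
  by exists (p ^+ n * q); rewrite quo_shiftM pw.
exists (p ^- n.+1 * q); rewrite quo_shiftM quo_shiftV pw NegzE.
by rewrite freegUN.
Qed.

End Iso.

Theorem theorem2 (F : groupType) (I : Type) (X : I -> F)
  (freeX : free_basis X)
  (fgF : finitely_generated F)
  (rank_ge2 : exists i j : I, i <> j) :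
  exists nAComm : normal_subgroup (AComm F),
    free_abelian_of_infinite_rank (quotient_group nAComm).
Proof.
have [r [Y [s [s_bij eY]]]] := free_basis_finite freeX fgF.
have freeY : free_on setT Y.
  by rewrite eY; apply: free_on_reindex s_bij (free_basis_on freeX).
have r_gt1 : 1 < r.
  have [s' sK s'K] := s_bij; have [i [j ij]] := rank_ge2.
  rewrite ltnNge; apply/negP => r1; apply: ij.
  rewrite -(s'K i) -(s'K j); congr s; apply: val_inj.
  have small (l : 'I_r) : val l = 0.
    by apply/eqP; rewrite -leqn0 -ltnS; exact: leq_trans (ltn_ord l) r1.
  by rewrite !small.
have nA := AComm_normal freeY (ltnW r_gt1); exists nA.
exists simple_key; split; first exact: simple_key_infinite.
exists (@quo_shift F nA); split; last exact: quo_shiftM.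
pose inv d := sval (cid (quo_shift_surj freeY r_gt1 nA d)).
have invK d : quo_shift (inv d) = d.
  exact: (svalP (cid (quo_shift_surj freeY r_gt1 nA d))).
exists inv => // q; apply: (quo_shift_inj freeY r_gt1); exact: invK.
Qed.
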